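(* Let $\underline{\eta}=[\eta_1,\dots,\eta_n]$ be an unordered collection of partitions of $d$ specifying the cycle types of branching of degree $d$ covers of $\mathbb{P}^1$ by connected curves of genus $g=0$. If $\underline{\eta}$ contains at most one $\eta_i$ that is not pure, and at least $d-3$ of the $\eta_i$ are transpositions (i.e. of cycle type $(2,1^{d-2})$), then the Hurwitz space $\mathrm{Hur}(\underline{\eta})$ is irreducible.
   Context: All curves are over $\mathbb{C}$. A partition of $d$ is pure if exactly one of its entries is not equal to $1$. The Hurwitz space of type $\underline{\eta}$, $$\mathrm{Hur}(\underline{\eta})=\{f:C\to\mathbb{P}^1\mid \text{the ramification of } f\text{ is of type }\underline{\eta}\},$$ is the space of (isomorphism classes of) degree $d$ covers $f$ with $C$ a smooth connected projective curve, branched over exactly $n$ distinct points of $\mathbb{P}^1$ (allowed to vary), such that the ramification profiles over these points are, in some order, $\eta_1,\dots,\eta_n$. Each $\eta_i$ is a non-trivial partition. The source curve has genus $0$, i.e. by Riemann–Hurwitz $\sum_{i=1}^n(d-\ell(\eta_i))=2d-2$, where $\ell(\eta_i)$ is the number of parts. Equivalently, covers correspond to conjugacy classes of tuples in $S_d$ with cycle types $\eta_i$, product one, generating a transitive subgroup, and irreducibility of $\mathrm{Hur}(\underline{\eta})$ is transitivity of the action on these classes obtained by moving the branch points. *)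

(* Defs.v *)
From mathcomp Require Import all_boot all_fingroup.

Set Implicit Arguments.
Unset Strict Implicit.
Unset Printing Implicit Defensive.

Local Open Scope group_scope.

(* Partitions of d are weakly decreasing sequences of positive integers. *)
Definition is_partition (d : nat) (p : seq nat) : bool :=
  [&& sorted geq p, 0 \notin p & sumn p == d].

Definition trivial_partition (d : nat) : seq nat := nseq d 1%N.

Definition transposition_type (d : nat) : seq nat := 2%N :: nseq (d - 2) 1%N.

Definition pure (p : seq nat) : bool := count (fun m => m != 1%N) p == 1%N.

(* Riemann-Hurwitz, 2g - 2 = -2d + sum_i (d - l(eta_i)), without subtraction
   of the constant terms. *)
Definition has_genus (g d n : nat) (eta : n.-tuple (seq nat)) : Prop :=
  (2 * g + 2 * d = \sum_(p <- eta) (d - size p) + 2)%N.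

(* Fixed points count as parts: porbits s contains the singleton orbits. *)
Definition cycle_type (d : nat) (s : 'S_d) : seq nat :=
  sort geq [seq #|X| | X : {set 'I_d} in porbits s].

Section Hurwitz.

Variables (n d : nat).

Definition branch_tuple := {ffun 'I_n -> 'S_d}.

Implicit Types (eta : n.-tuple (seq nat)) (t : branch_tuple).

(* Monodromy of connected degree d covers of P^1 along a standard system of
   loops around n ordered branch points; the profiles eta occur in some
   order. *)
Definition monodromy_tuples eta : {set branch_tuple} :=
  [set t : branch_tuple |
    [&& perm_eq [seq cycle_type (t i) | i : 'I_n] eta,
        \prod_(i < n) t i == 1
      & [transitive <<[set t i | i : 'I_n]>>, on [set: 'I_d] | 'P]]].

(* The sheets of a cover are not labelled. *)
Definition conj_tuple t (x : 'S_d) : branch_tuple := [ffun i => t i ^ x].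

Definition conj_class t : {set branch_tuple} :=
  [set conj_tuple t x | x : 'S_d].

(* The isomorphism classes of covers with ramification type eta and a fixed
   branch locus, i.e. a fibre of the branch map from Hur(eta) to the space of
   n unordered distinct points of P^1. *)
Definition hurwitz_fibre eta : {set {set branch_tuple}} :=
  [set conj_class t | t in monodromy_tuples eta].

(* For j = i + 1, the half twist exchanging the branch points i and j:
   (..., a, b, ...) |-> (..., b, b^-1 a b, ...). *)
Definition half_twist_fun (i j : 'I_n) t : branch_tuple :=
  [ffun k => if k == i then t j else if k == j then t i ^ t j else t k].

Lemma half_twist_fun_inj (i j : 'I_n) : injective (half_twist_fun i j).
Proof.
move=> t u /ffunP eq_tu; apply/ffunP=> k.
have tuj: t j = u j by move: (eq_tu i); rewrite !ffunE eqxx.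
have [-> // | neq_kj] := eqVneq k j.
have [eq_ki | neq_ki] := eqVneq k i; last first.
  by move: (eq_tu k); rewrite !ffunE (negPf neq_ki) (negPf neq_kj).
move: (eq_tu j); rewrite !ffunE eqxx -eq_ki eq_sym (negPf neq_kj) tuj.
exact: conjg_inj.
Qed.

Definition half_twist (i j : 'I_n) : {perm branch_tuple} :=
  perm (@half_twist_fun_inj i j).

(* The image in the permutations of branch_tuple of the braid group on n
   strands, which surjects onto the fundamental group of the space of n
   unordered distinct points of P^1. *)
Definition braid_group : {group {perm branch_tuple}} :=
  <<[set half_twist ij.1 ij.2 |
      ij in [set ij : 'I_n * 'I_n | ij.2 == ij.1.+1 :> nat]]>>%G.

(* Hur(eta) is a finite etale cover of the irreducible smooth variety of n
   unordered distinct points of P^1, so it is irreducible if and only if the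
   monodromy action on a fibre of the branch map is transitive. The fibre is
   required to be nonempty, since [transitive A, on S | to] fails when S is
   empty. *)
Definition hurwitz_irreducible eta : Prop :=
  [transitive braid_group, on hurwitz_fibre eta | 'P^*].

End Hurwitz.

Arguments hurwitz_irreducible {n} d eta.

(* Main.v *)
Require Import Defs.
From mathcomp Require Import all_boot all_fingroup zify.

(** Number the sheets and let [defect s = d - #cycles s].  Ree's inequality, i.e.
    g >= 0, is the only geometric input: a transitive tuple with product 1 has
    total defect at least 2d - 2, and a factorization whose defects add up to the
    defect of its product [z] has all its factors inside the cycles of [z].

    Let h have the impure type, or the type of largest defect if all of them are
    pure, and let l be its number of cycles.  The hypotheses leave at least
    l - 1 transpositions besides h.  As long as h is not a d-cycle, genus 0 lets
    us braid one of them so that it joins two cycles of h.  After l - 1 steps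
    the tuple reads (h, t_1, ..., t_(l-1), c_1, ..., c_r) with
    z = h t_1 ... t_(l-1) a d-cycle, so that z and z^-1 are factored minimally
    by (h, t_1, ..., t_(l-1)) and (c_1, ..., c_r).

    Both kinds of minimal factorization are unique up to braiding: one peels off
    the last factor, which is determined by its defect (or by the length of the
    cycle of h that it cuts off) up to conjugation by a power of z, and the full
    twist realizes this conjugation while fixing the product z.  Since any two
    d-cycles are conjugate, all tuples are equivalent. *)

Set Implicit Arguments.
Unset Strict Implicit.
Unset Printing Implicit Defensive.

(** * Cycle partitions and Ree's inequality *)

Section Defect.

Local Open Scope group_scope.

Variable T : finType.
Implicit Types (s t u g J : {perm T}) (x y z : T) (L : seq {perm T}).

(** The number [d - 3] arises as follows: an [h] of defect at least 2 has at most [d - 2] cycles,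
    hence needs at most [d - 3] joining transpositions. If all types are transpositions, genus 0
    provides [2 * d - 2] of them. Purity makes every factor other than [h] a single cycle, whose
    type is determined by its defect, so that matching defects amounts to matching types.

    The obstacle in the joining step is a transposition with both ends in one cycle of [h], which
    would cut this cycle. Once all cycles are joined, [h] and its transpositions account for [d - 1]
    of the total defect [2 * d - 2]. The remaining [d - 1] is the least possible for factors of a
    full cycle, which is why both halves are minimal.

    Irreducibility includes a nonempty fibre, so a tuple must also be constructed.

    A permutation [J] often stands for a set partition: [refines s J] places every cycle of [s]
    inside a cycle of [J], and only the cycles of [J] matter. *)

Definition refines s J := forall z, s z \in porbit J z.

(** The contribution of a branch point to the Riemann-Hurwitz formula; also the least number of
    transpositions with product [s]. *)
Definition defect s := #|T| - #|porbits s|.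

Definition defect_sum L := sumn [seq defect s | s <- L].

Definition mulseq L : {perm T} := \prod_(s <- L) s.

(* mulgA for the canonical structures found in [s * t]: lia does not identify
   products that are merely convertible. *)
Lemma mulpA s t u : s * (t * u) = s * t * u.
Proof. exact: mulgA. Qed.

Lemma mulseq0 : mulseq [::] = 1.
Proof. exact: big_nil. Qed.

Lemma mulseq_cons s L : mulseq (s :: L) = s * mulseq L.
Proof. exact: big_cons. Qed.

Lemma mulseq_cat L1 L2 : mulseq (L1 ++ L2) = mulseq L1 * mulseq L2.
Proof. exact: big_cat. Qed.

Lemma mulseq_rcons L s : mulseq (rcons L s) = mulseq L * s.
Proof. by rewrite -cats1 mulseq_cat mulseq_cons mulseq0 mulg1. Qed.

Lemma defect_sum_cat L1 L2 : defect_sum (L1 ++ L2) = defect_sum L1 + defect_sum L2.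
Proof. by rewrite /defect_sum map_cat sumn_cat. Qed.

Lemma defect_sum_cons s L : defect_sum (s :: L) = defect s + defect_sum L.
Proof. by []. Qed.

Lemma defect_sum_rcons L s : defect_sum (rcons L s) = defect_sum L + defect s.
Proof. by rewrite -cats1 defect_sum_cat /defect_sum /= addn0. Qed.

Lemma porbit_trans s x y z :
  x \in porbit s y -> y \in porbit s z -> x \in porbit s z.
Proof. by rewrite -!eq_porbit_mem => /eqP-> /eqP->. Qed.

Lemma porbit_eq s x y : x \in porbit s y -> porbit s x = porbit s y.
Proof. by rewrite -eq_porbit_mem => /eqP. Qed.

Lemma porbit1 x y : (y \in porbit (1 : {perm T}) x) = (y == x).
Proof.
apply/porbitP/eqP => [[i ->]|->]; first by rewrite expg1n perm1.
by exists 0; rewrite perm1.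
Qed.

Lemma closed_porbit s (B : {pred T}) x y :
  (forall z, z \in B -> s z \in B) -> x \in B -> y \in porbit s x -> y \in B.
Proof.
move=> sB xB /porbitP[i ->]; elim: i => [|i IHi]; first by rewrite perm1.
by rewrite expgSr permM sB.
Qed.

Lemma porbitM s x : s x \in porbit s x.
Proof. by rewrite -{1}[s]expg1 mem_porbit. Qed.

Lemma porbitS s x y : (s y \in porbit s x) = (y \in porbit s x).
Proof.
apply/idP/idP => [|yx]; last exact: porbit_trans (porbitM s y) yx.
by apply: porbit_trans; rewrite porbit_sym porbitM.
Qed.

Lemma refines_porbit s J x y : refines s J -> y \in porbit s x -> y \in porbit J x.
Proof.
move=> sJ; apply: closed_porbit; last exact: porbit_id.
by move=> z; apply: porbit_trans.
Qed.

Lemma refines_refl s : refines s s.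
Proof. by move=> z; apply: porbitM. Qed.

Lemma refines_trans s t u : refines s t -> refines t u -> refines s u.
Proof. by move=> st tu z; apply: refines_porbit tu (st z). Qed.

Lemma refines1 J : refines 1 J.
Proof. by move=> z; rewrite perm1 porbit_id. Qed.

Lemma refinesM s t J : refines s J -> refines t J -> refines (s * t) J.
Proof. by move=> sJ tJ z; rewrite permM; apply: porbit_trans (tJ _) (sJ _). Qed.

Lemma refinesV s J : refines s J -> refines s^-1 J.
Proof. by move=> sJ z; rewrite porbit_sym -{1}[z](permKV s) sJ. Qed.

Lemma refinesX s J i : refines s J -> refines (s ^+ i) J.
Proof.
move=> sJ; elim: i => [|i IHi]; first exact: refines1.
by rewrite expgS; apply: refinesM.
Qed.

Lemma refinesJ s g J : refines s J -> refines g J -> refines (s ^ g) J.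
Proof. by move=> sJ gJ; apply/refinesM/refinesM => //; apply: refinesV. Qed.

Lemma refines_prod L J :
  (forall s, s \in L -> refines s J) -> refines (mulseq L) J.
Proof.
elim: L => [|s L IHL] LJ; first by rewrite mulseq0; apply: refines1.
rewrite mulseq_cons; apply: refinesM; first by apply: LJ; rewrite mem_head.
by apply: IHL => u uL; apply: LJ; rewrite inE uL orbT.
Qed.

Lemma refines_tperm x y J : x \in porbit J y -> refines (tperm x y) J.
Proof.
by move=> xy z; case: tpermP => [->|->|_ _]; rewrite ?porbit_id // porbit_sym.
Qed.

Lemma refines_move s J x y : refines s J -> (s x \in porbit J y) = (x \in porbit J y).
Proof.
move=> sJ; apply/idP/idP => [|xy]; last exact: porbit_trans (sJ x) xy.
by apply: porbit_trans; rewrite porbit_sym.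
Qed.

Lemma mem_porbits s x : porbit s x \in porbits s.
Proof. by rewrite imset_f. Qed.

Lemma porbits_mem s (X : {set T}) x : X \in porbits s -> x \in X -> X = porbit s x.
Proof. by case/imsetP=> y _ -> /porbit_eq->. Qed.

(** Every cycle of [J] is a union of cycles of [s], so [f] is a surjection between the sets of
    cycles, and refinement can be studied by counting. *)
Lemma refines_porbits s J : refines s J ->
  {f : {set T} -> {set T} | porbits J = f @: porbits s
                          & forall x, f (porbit s x) = porbit J x}.
Proof.
move=> sJ; pose f (X : {set T}) := \bigcup_(x in X) porbit J x.
have fE x : f (porbit s x) = porbit J x.
  apply/setP=> z; apply/bigcupP/idP => [[w ws zw]|zx].
    exact: porbit_trans zw (refines_porbit sJ ws).
  by exists x; rewrite ?porbit_id.
exists f => //; apply/setP=> X; apply/imsetP/imsetP => [[x _ ->]|[_ /imsetP[x _ ->]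
  ->]].
  by exists (porbit s x); rewrite ?fE ?mem_porbits.
by exists x; rewrite ?fE.
Qed.

Lemma refines_card s J : refines s J -> #|porbits J| <= #|porbits s|.
Proof. by case/refines_porbits=> f -> _; apply: leq_imset_card. Qed.

(** The surjection between the sets of cycles becomes injective; the points [z] and [J z] share a
    cycle of [J], hence one of [s]. *)
Lemma refines_eq s J : refines s J -> #|porbits s| <= #|porbits J| -> refines J s.
Proof.
case/refines_porbits=> f -> fE le_sf.
have/imset_injP f_inj : #|f @: porbits s| == #|porbits s|.
  by rewrite eqn_leq leq_imset_card.
move=> z; rewrite -eq_porbit_mem; apply/eqP/f_inj; rewrite ?mem_porbits // !fE.
have -> : porbit J (J z) = porbit J z by apply/porbit_eq/porbitM.
by [].
Qed.

Lemma card_porbits_le s : #|porbits s| <= #|T|.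
Proof. by rewrite (leq_trans (leq_imset_card _ _)) // max_card. Qed.

Lemma defect_porbits s : defect s + #|porbits s| = #|T|.
Proof. by rewrite subnK // card_porbits_le. Qed.

Lemma refines_defect s J : refines s J -> defect s <= defect J.
Proof. by move/refines_card; rewrite /defect; lia. Qed.

Lemma refines_defect_eq s J : refines s J -> defect J <= defect s -> refines J s.
Proof.
move=> sJ le_i; apply: refines_eq => //.
by have := defect_porbits s; have := defect_porbits J; lia.
Qed.

Lemma defectV s : defect s^-1 = defect s.
Proof. by rewrite /defect porbitsV. Qed.

Lemma porbitJ s g x : porbit (s ^ g) (g x) = g @: porbit s x.
Proof.
apply/setP=> y; apply/porbitP/imsetP => [[i ->]|[_ /porbitP[i ->] ->]].
  by exists ((s ^+ i) x); rewrite ?mem_porbit // -conjXg permJ.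
by exists i; rewrite -conjXg permJ.
Qed.

Lemma porbitsJ s g : porbits (s ^ g) = [set g @: (X : {set T}) | X in porbits s].
Proof.
apply/setP=> X; apply/imsetP/imsetP => [[x _ ->]|[_ /imsetP[x _ ->] ->]].
  by exists (porbit s (g^-1 x)); rewrite ?mem_porbits // -porbitJ permKV.
by exists (g x); rewrite ?porbitJ.
Qed.

Lemma card_porbitsJ s g : #|porbits (s ^ g)| = #|porbits s|.
Proof. by rewrite porbitsJ card_imset //; apply/imset_inj/perm_inj. Qed.

Lemma defectJ s g : defect (s ^ g) = defect s.
Proof. by rewrite /defect card_porbitsJ. Qed.

Lemma defect1 : defect 1 = 0.
Proof.
rewrite /defect /porbits card_imset ?subnn // => x y /eqP.
by rewrite eq_porbit_mem porbit1 => /eqP.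
Qed.

Lemma defect_eq0 s : (defect s == 0) = (s == 1).
Proof.
apply/eqP/eqP => [s0|->]; last exact: defect1.
have s1 : refines s 1 by apply: refines_defect_eq (refines1 s) _; rewrite s0 defect1.
by apply/permP=> z; have := s1 z; rewrite porbit1 perm1 => /eqP.
Qed.

Lemma defect_gt0 s : (0 < defect s) = (s != 1).
Proof. by rewrite lt0n defect_eq0. Qed.

(** * Products with a transposition *)

Lemma card_porbits_mul_tperm s x y :
  #|porbits (s * tperm x y)| + (x \notin porbit s y).*2 = #|porbits s| + (x != y).
Proof.
(* Inversion keeps the cycles and moves the transposition to the left, the side of
   [porbits_mul_tperm]. *)
rewrite -porbitsV invMg tpermV -porbitV -(porbitsV s).
exact: porbits_mul_tperm.
Qed.

Lemma defect_join s x y :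
  x \notin porbit s y -> defect (s * tperm x y) = (defect s).+1.
Proof.
move=> xy; have := card_porbits_mul_tperm s x y; rewrite xy.
have -> : x != y by apply: contraNneq xy => ->; rewrite porbit_id.
by have := defect_porbits s; have := defect_porbits (s * tperm x y); lia.
Qed.

Lemma defect_cut s x y :
  x != y -> x \in porbit s y -> (defect (s * tperm x y)).+1 = defect s.
Proof.
move=> nxy xy; have := card_porbits_mul_tperm s x y; rewrite xy nxy.
by have := defect_porbits s; have := defect_porbits (s * tperm x y); lia.
Qed.

Lemma defect_mul_tperm_le s x y : defect (s * tperm x y) <= (defect s).+1.
Proof.
have [->|nxy] := eqVneq x y; first by rewrite tperm1 mulg1.
have [xy|xy] := boolP (x \in porbit s y); last by rewrite defect_join.
by have := defect_cut nxy xy; lia.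
Qed.

Lemma mulgK_tperm s x y : s * tperm x y * tperm x y = s.
Proof. by rewrite -mulgA tperm2 mulg1. Qed.

Lemma join_mem s x y :
  x \notin porbit s y -> x \in porbit (s * tperm x y) y.
Proof.
move=> xy; apply: contraT => xy'; have := defect_join xy'.
by rewrite mulgK_tperm defect_join //; lia.
Qed.

Lemma refines_mul_tperm s x y :
  x \in porbit (s * tperm x y) y -> refines s (s * tperm x y).
Proof.
by rewrite -{2}(mulgK_tperm s x y) => xy; apply: refinesM (refines_refl _)
  (refines_tperm xy).
Qed.

Lemma refines_join s x y :
  x \notin porbit s y -> refines s (s * tperm x y).
Proof. by move/join_mem/refines_mul_tperm. Qed.

Lemma porbits_mul_tperm_notin s x y (X : {set T}) :
  X \in porbits s -> x \notin X -> y \notin X -> X \in porbits (s * tperm x y).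
Proof.
case/imsetP=> z _ -> xX yX; apply/imsetP; exists z => //.
have tE w : w \in porbit s z -> tperm x y w = w.
  by move=> wz; apply: tpermD; [apply: contraNneq xX | apply: contraNneq yX] => ->.
have powE i : ((s * tperm x y) ^+ i) z = (s ^+ i) z.
  elim: i => [|i IHi]; first by rewrite !perm1.
  by rewrite !expgSr !permM IHi tE // -permM -expgSr mem_porbit.
by apply/setP=> w; apply/porbitP/porbitP => -[i ->]; exists i; rewrite powE.
Qed.

Lemma perm_neq1P s : s != 1 -> exists x, s x != x.
Proof.
move=> s1; apply/existsP; apply: contraR s1; rewrite negb_exists => /forallP s1.
by apply/eqP/permP=> x; rewrite perm1; apply/eqP; have := s1 x; rewrite negbK.
Qed.

(** Multiplying [s] by the transposition of [s x] and [x] makes [x] a fixed point, cut off from its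
    cycle. This is the step of the inductions on the defect. *)
Lemma split_tperm s : s != 1 ->
  exists t x y, [/\ s = t * tperm x y, x != y, refines t s, refines (tperm x y) s
                  & defect s = (defect t).+1].
Proof.
case/perm_neq1P=> x sx.
have xy := porbitM s x; exists (s * tperm (s x) x), (s x), x.
have ts := refines_tperm xy.
rewrite mulgK_tperm; split => //; last by rewrite defect_cut.
exact: refinesM (refines_refl s) ts.
Qed.

Lemma defect1P s : defect s = 1%N -> exists x y, x != y /\ s = tperm x y.
Proof.
move=> s1; have /split_tperm[t [x [y [sE nxy _ _]]]] : s != 1.
  by rewrite -defect_gt0 s1.
rewrite s1 => -[/esym/eqP]; rewrite defect_eq0 => /eqP t1.
by exists x, y; rewrite sE t1 mul1g.
Qed.

Lemma defect_tperm x y : x != y -> defect (tperm x y) = 1%N.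
Proof.
move=> nxy; rewrite -[tperm x y]mul1g defect_join ?defect1 //.
by rewrite porbit1.
Qed.

Lemma defect_mul_le s t : defect (s * t) <= defect s + defect t.
Proof.
have [n] := ubnP (defect t); elim: n t => // n IHn t lt_n.
have [->|t1] := eqVneq t 1; first by rewrite mulg1 leq_addr.
have [u [x [y [tE _ _ _ it]]]] := split_tperm t1.
rewrite {1}tE mulgA (leq_trans (defect_mul_tperm_le _ _ _)) //.
by rewrite it addnS ltnS IHn // -ltnS -it.
Qed.

Lemma defect_prod_le L : defect (mulseq L) <= defect_sum L.
Proof.
elim: L => [|s L IHL]; first by rewrite mulseq0 defect1.
by rewrite mulseq_cons (leq_trans (defect_mul_le _ _)) ?leq_add2l.
Qed.

(** Here [n] is the defect sum of the factors already multiplied into [q]. The factor [s] is added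
    one transposition at a time. A transposition inside a cycle of [J] raises [defect s] by one,
    which pays for a possible drop in the defect of the product. Otherwise it joins two cycles of
    [J], hence two of the product, and both sides grow by 2. *)
Lemma join_defect_step q J s n :
  refines q J -> 2 * defect J <= n + defect q ->
  exists J', [/\ refines J J', refines s J'
               & 2 * defect J' <= n + defect s + defect (q * s)].
Proof.
have [m] := ubnP (defect s); elim: m s => // m IHm s lt_m qJ le_J.
have [->|s1] := eqVneq s 1.
  by exists J; rewrite mulg1 defect1 addn0; split=> //;
    [exact: refines_refl | exact: refines1].
have [u [x [y [sE nxy _ _ is_u]]]] := split_tperm s1.
have [|J1 [JJ1 uJ1 le_J1]] := IHm u _ qJ le_J; first by lia.
have quJ1 : refines (q * u) J1 by apply: refinesM uJ1; apply: refines_trans JJ1.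
have qsE : q * s = q * u * tperm x y by rewrite sE mulgA.
have [xy|xy] := boolP (x \in porbit J1 y).
  exists J1; split=> //; first by rewrite sE; apply: refinesM (refines_tperm xy).
  have := defect_mul_tperm_le (q * s) x y.
  by rewrite {1}qsE mulgK_tperm is_u; lia.
exists (J1 * tperm x y); split; first exact: refines_trans (refines_join xy).
  rewrite sE; apply: refinesM; first exact: refines_trans (refines_join xy).
  exact/refines_tperm/join_mem.
have quxy : x \notin porbit (q * u) y by apply: contra xy => /(refines_porbit quJ1).
by rewrite (defect_join xy) is_u qsE (defect_join quxy); lia.
Qed.

(* Ree's inequality, the nonnegativity of the genus: the cycles of J are the
   orbits of the group generated by L. *)
Lemma ree_inequality L : exists J,
  (forall s, s \in L -> refines s J) /\
  2 * defect J <= defect_sum L + defect (mulseq L).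
Proof.
elim/last_ind: L => [|L s [J [LJ le_J]]].
  by exists 1; rewrite mulseq0 defect1.
have [|J' [JJ' sJ' le_J']] := join_defect_step s _ le_J; first exact: refines_prod.
exists J'; split=> [u|].
  by rewrite mem_rcons inE => /predU1P[->//|/LJ uJ]; apply: refines_trans JJ'.
by rewrite defect_sum_rcons mulseq_rcons.
Qed.

(* The hypothesis, whose converse is defect_prod_le, makes Ree's inequality sharp:
   J has the same cycles as the product. *)
Lemma minimal_refines L s :
  defect_sum L <= defect (mulseq L) -> s \in L ->
  refines s (mulseq L).
Proof.
move=> minL sL; have [J [LJ le_J]] := ree_inequality L.
apply: refines_trans (LJ s sL) _; apply: refines_defect_eq; first exact: refines_prod.
lia.
Qed.

End Defect.

(** * Hurwitz moves on factorizations *)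

Section HurwitzMoves.

Local Open Scope group_scope.

Variable T : finType.
Implicit Types (s t u g J : {perm T}) (x y z : T) (L : seq {perm T}).

(** Braid equivalence; symmetry supplies the inverse half twists. Lists replace tuples indexed by
    ['I_n] because the inductions peel off factors and thus change the length. *)
Inductive hurwitz : seq {perm T} -> seq {perm T} -> Prop :=
| hurwitz_refl L : hurwitz L L
| hurwitz_sym L1 L2 : hurwitz L1 L2 -> hurwitz L2 L1
| hurwitz_trans L1 L2 L3 : hurwitz L1 L2 -> hurwitz L2 L3 -> hurwitz L1 L3
| hurwitz_step L1 s t L2 :
    hurwitz (L1 ++ s :: t :: L2) (L1 ++ t :: s ^ t :: L2).

Lemma hurwitz_mulseq L1 L2 : hurwitz L1 L2 -> mulseq L1 = mulseq L2.
Proof.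
elim=> // [p q r _ -> //|p s t q].
by rewrite !mulseq_cat !mulseq_cons (mulgA s) (mulgA t) -conjgC.
Qed.

Lemma hurwitz_perm (R : eqType) (f : {perm T} -> R) L1 L2 :
  (forall s g, f (s ^ g) = f s) ->
  hurwitz L1 L2 -> perm_eq (map f L1) (map f L2).
Proof.
move=> fJ; elim=> // [p q _|p q r _ pq _|p s t q].
- by rewrite perm_sym.
- exact: perm_trans.
rewrite !map_cat /= fJ perm_cat2l.
by rewrite -(cat1s (f s)) -(cat1s (f t)) -[f t :: f s :: _](cat1s (f t)) -[f s :: map
  f q]cat1s perm_catCA.
Qed.

Lemma hurwitz_size L1 L2 : hurwitz L1 L2 -> size L1 = size L2.
Proof.
by move/(hurwitz_perm (f := fun=> tt))=> /(_ (fun _ _ => erefl))/perm_size;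
  rewrite !size_map.
Qed.

Lemma hurwitz_defect L1 L2 :
  hurwitz L1 L2 -> perm_eq (map (@defect T) L1) (map (@defect T) L2).
Proof. by apply: hurwitz_perm => s g; apply: defectJ. Qed.

Lemma hurwitz_defect_sum L1 L2 : hurwitz L1 L2 -> defect_sum L1 = defect_sum L2.
Proof. by move/hurwitz_defect/perm_sumn. Qed.

(** Closure under inverses serves the backward direction, where [s] is recovered from [s ^ t] by
    conjugation with [t^-1]. *)
Lemma hurwitz_all (K : {perm T} -> Prop) L1 L2 :
    (forall s t, K s -> K t -> K (s ^ t)) -> (forall s, K s -> K s^-1) ->
  hurwitz L1 L2 ->
  (forall s, s \in L1 -> K s) <-> (forall s, s \in L2 -> K s).
Proof.
move=> KJ KV; elim=> // [p q _ []//|p q r _ [] pq qp _ []|p s t q]; first by split;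
  auto.
have sub v u w : (forall r, r \in p ++ [:: v, u & q] -> K r) -> K w ->
    forall r, r \in p ++ [:: u, w & q] -> K r.
  move=> Kvu Kw r; rewrite mem_cat !inE => /or4P[rp|/eqP->|/eqP->//|rq];
  by apply: Kvu; rewrite mem_cat !inE ?rp ?rq ?eqxx ?orbT.
split=> Kst; first by apply: (sub _ _ _ Kst); apply: KJ; apply: Kst;
  rewrite mem_cat !inE eqxx ?orbT.
have Kt : K t by apply: Kst; rewrite mem_cat !inE eqxx ?orbT.
have Ks : K s.
  by rewrite -(conjgK t s); apply/KJ/KV/Kt/Kst; rewrite mem_cat !inE eqxx ?orbT.
move=> r; rewrite mem_cat !inE => /or4P[rp|/eqP->//|/eqP->//|rq];
by apply: Kst; rewrite mem_cat !inE ?rp ?rq ?eqxx ?orbT.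
Qed.

Lemma hurwitz_cat p q L1 L2 : hurwitz L1 L2 -> hurwitz (p ++ L1 ++ q) (p ++ L2 ++ q).
Proof.
elim=> [L|M N _ /hurwitz_sym //|M N K _ MN _|M s t N]; first exact: hurwitz_refl.
  exact: hurwitz_trans.
by rewrite -!catA !(catA p); apply: hurwitz_step.
Qed.

Lemma hurwitz_catl p L1 L2 : hurwitz L1 L2 -> hurwitz (p ++ L1) (p ++ L2).
Proof. by move/(hurwitz_cat p [::]); rewrite !cats0. Qed.

Lemma hurwitz_catr q L1 L2 : hurwitz L1 L2 -> hurwitz (L1 ++ q) (L2 ++ q).
Proof. exact: (hurwitz_cat [::] q). Qed.

Lemma hurwitz_cons s L1 L2 : hurwitz L1 L2 -> hurwitz (s :: L1) (s :: L2).
Proof. exact: (hurwitz_catl [:: s]). Qed.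

Lemma hurwitz_rcons s L1 L2 : hurwitz L1 L2 -> hurwitz (rcons L1 s) (rcons L2 s).
Proof. by rewrite -!cats1; apply: hurwitz_catr. Qed.

(** * Simultaneous conjugation and the full twist *)

Definition conjseq L g := [seq s ^ g | s <- L].

Lemma hurwitz_conj g L1 L2 : hurwitz L1 L2 -> hurwitz (conjseq L1 g) (conjseq L2 g).
Proof.
rewrite /conjseq; elim=> [L|M N _ /hurwitz_sym //|M N K _ MN _|M s t N].
- exact: hurwitz_refl.
- exact: hurwitz_trans.
by rewrite !map_cat /= conjJg; apply: hurwitz_step.
Qed.

Lemma mulseq_conj g L : mulseq (conjseq L g) = mulseq L ^ g.
Proof.
elim: L => [|s L IHL]; first by rewrite !mulseq0 conj1g.
by rewrite /= !mulseq_cons conjMg IHL.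
Qed.

Lemma conjseq1 L : conjseq L 1 = L.
Proof. by elim: L => //= s L ->; rewrite conjg1. Qed.

Lemma conjseqM L g h : conjseq L (g * h) = conjseq (conjseq L g) h.
Proof. by elim: L => //= s L ->; rewrite conjgM. Qed.

Lemma conjseq_rcons L s g : conjseq (rcons L s) g = rcons (conjseq L g) (s ^ g).
Proof. exact: map_rcons. Qed.

Lemma conjseq_cat L1 L2 g : conjseq (L1 ++ L2) g = conjseq L1 g ++ conjseq L2 g.
Proof. exact: map_cat. Qed.

Lemma hurwitz_swap s t L : hurwitz (s :: t :: L) (t :: s ^ t :: L).
Proof. exact: (hurwitz_step [::]). Qed.

Lemma hurwitz_front L1 s L2 :
  hurwitz (L1 ++ s :: L2) (s :: conjseq L1 s ++ L2).
Proof.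
elim: L1 => [|t L1 IH] /=; first exact: hurwitz_refl.
exact: hurwitz_trans (hurwitz_cons t IH) (hurwitz_swap _ _ _).
Qed.

Lemma hurwitz_mem_front s L : s \in L ->
  exists L', hurwitz L (s :: L').
Proof.
case/splitPr=> L1 L2; exists (conjseq L1 s ++ L2).
exact: hurwitz_front.
Qed.

Lemma conjg_self s : s ^ s = s.
Proof. by rewrite conjgE mulKg. Qed.

Lemma conjg_selfX s i : s ^ (s ^+ i) = s.
Proof. by rewrite conjgE -expgS expgSr mulKg. Qed.

Lemma hurwitz_back s L : hurwitz (s :: L) (rcons L (s ^ mulseq L)).
Proof.
elim: L s => [|t L IH] s; first by rewrite mulseq0 conjg1; apply: hurwitz_refl.
rewrite mulseq_cons conjgM.
exact: hurwitz_trans (hurwitz_swap _ _ _) (hurwitz_cons t (IH _)).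
Qed.

(** A factor moved to the end is conjugated by the product of all it passes. Multiplying this
    product by the factor itself does not change the conjugate, so the conjugator is the whole
    product, the same for all factors of [L1]. *)
Lemma hurwitz_rotate L1 L2 :
  hurwitz (L1 ++ L2) (L2 ++ conjseq L1 (mulseq (L1 ++ L2))).
Proof.
elim: L1 L2 => [|s L1 IH] L2; first by rewrite cats0; apply: hurwitz_refl.
set P := mulseq _; apply: (hurwitz_trans (hurwitz_back _ _)).
have -> : s ^ mulseq (L1 ++ L2) = s ^ P.
  by rewrite /P /= mulseq_cons conjgM conjg_self.
rewrite rcons_cat; apply: (hurwitz_trans (IH _)).
have -> : mulseq (L1 ++ rcons L2 (s ^ P)) = P.
  by rewrite -rcons_cat mulseq_rcons /P /= mulseq_cons conjgM conjg_self -conjgC.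
by rewrite cat_rcons; apply: hurwitz_refl.
Qed.

(** Rotating the whole list is the full twist. It fixes the product, so it can be iterated; applied
    to part of a tuple, it turns these factors along the cycles of their product. *)
Lemma hurwitz_twist L i : hurwitz L (conjseq L (mulseq L ^+ i)).
Proof.
elim: i => [|i IHi]; first by rewrite conjseq1; apply: hurwitz_refl.
apply: (hurwitz_trans IHi); have := hurwitz_rotate (conjseq L (mulseq L ^+ i)) [::].
by rewrite !cats0 mulseq_conj conjg_selfX -conjseqM -expgSr.
Qed.

End HurwitzMoves.

(** * Joining the cycles of one factor in genus 0 *)

Section Joining.

Local Open Scope group_scope.

Variable T : finType.
Implicit Types (s t u g H J : {perm T}) (x y z : T) (L : seq {perm T}) (B : {set T}).

Definition preserves B s := forall z, (s z \in B) = (z \in B).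

(** Transitivity of the generated group, phrased with invariant subsets so that it is easy to carry
    along Hurwitz moves. *)
Definition connected L :=
  forall B, B != set0 -> (forall s, s \in L -> preserves B s) -> B = [set: T].

Lemma preservesP B s : (forall z, z \in B -> s z \in B) -> preserves B s.
Proof.
move=> sB z; apply/idP/idP=> [szB|/sB//].
by apply: closed_porbit sB szB _; rewrite porbit_sym porbitM.
Qed.

Lemma refines_preserves B s J : refines s J -> preserves B J -> preserves B s.
Proof.
move=> sJ JB; apply: preservesP => z zB.
by apply: closed_porbit (zB) (sJ z) => w; rewrite JB.
Qed.

Lemma preserves_porbit s J x : refines s J -> preserves (porbit J x) s.
Proof. by move=> sJ z; apply: refines_move. Qed.

Lemma hurwitz_connected L1 L2 : hurwitz L1 L2 -> connected L1 -> connected L2.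
Proof.
move=> L12 conL B B0; have KV s : preserves B s -> preserves B s^-1.
  by move=> sB z; rewrite -{2}[z](permKV s) sB.
have KJ s t : preserves B s -> preserves B t -> preserves B (s ^ t).
  by move=> sB tB z; rewrite !permM tB sB KV.
have [_ L21] := hurwitz_all KJ KV L12.
by move/L21; apply: conL.
Qed.

Lemma connected_porbit L J x : connected L ->
  (forall s, s \in L -> refines s J) -> porbit J x = [set: T].
Proof.
move=> conL LJ; apply: conL; first by apply/set0Pn; exists x; apply: porbit_id.
by move=> s sL; apply/preserves_porbit/LJ.
Qed.

Lemma card_porbits_full s x : porbit s x = [set: T] -> #|porbits s| = 1%N.
Proof.
move=> sx; suff -> : porbits s = [set [set: T]] by rewrite cards1.
apply/setP=> X; rewrite inE; apply/imsetP/eqP => [[y _ ->]|->].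
  by rewrite -sx; apply: porbit_eq; rewrite porbit_sym porbit_sym sx inE.
by exists x.
Qed.

Lemma porbit_mul_tperm_sub s x y z :
  z \in porbit (s * tperm x y) x -> (z \in porbit s x) || (z \in porbit s y).
Proof.
rewrite -in_setU; apply: closed_porbit; last by rewrite inE porbit_id.
move=> w; rewrite permM; case: tpermP => [_|_|_ _].
- by rewrite !inE porbit_id orbT.
- by rewrite !inE porbit_id.
by rewrite !inE !porbitS.
Qed.

(** Let D be the cycle of [H] through [x] and [y]. A full twist of [A], whose product is [U^-1],
    turns [a] into a conjugate [b] that moves [x] itself out of D; two half twists then replace the
    transposition by its conjugate under [b]. If the new ends [b x] and [b y] shared a cycle of [H],
    this cycle would avoid D and so be a cycle of [U]; then [x] and [y] would share a cycle of
    [J]. *)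
Lemma push_transposition H J A a x y z :
    mulseq (H :: tperm x y :: A) = 1 -> x \in porbit H y ->
    (forall s, s \in H * tperm x y :: A -> refines s J) -> y \notin porbit J x ->
    a \in A -> z \in porbit (H * tperm x y) x -> a z \notin porbit H x ->
  exists x' y' A',
    hurwitz (tperm x y :: A) (tperm x' y' :: A') /\ x' \notin porbit H y'.
Proof.
set t := tperm x y; set U := H * t; rewrite !mulseq_cons mulgA -/U => UA1 xy.
move=> UAJ xyJ aA zx azH.
have AU : mulseq A = U^-1 by apply/esym/eqP; rewrite eq_invg_mul UA1.
have UJ : refines U J by apply: UAJ; rewrite mem_head.
have UH : refines U H by apply: refinesM (refines_refl H) (refines_tperm xy).
have /porbitP[i xE] : x \in porbit U^-1 z by rewrite porbitV porbit_sym.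
set g := U^-1 ^+ i in xE; pose b := a ^ g.
have bx : b x = g (a z) by rewrite xE permJ.
have bJ : refines b J.
  apply: refinesJ; last exact/refinesX/refinesV.
  by apply: UAJ; rewrite inE aA orbT.
have [A' AA'] : exists A', hurwitz A (b :: A').
  have bA : b \in conjseq A g by apply: map_f.
  have [A' AA'] := hurwitz_mem_front bA; exists A'.
  by apply: hurwitz_trans AA'; rewrite /g -AU; apply: hurwitz_twist.
exists (b x), (b y), (b ^ (t ^ b) :: A'); split.
  rewrite -tpermJ -/t; apply: hurwitz_trans (hurwitz_cons t AA') _.
  exact: hurwitz_trans (hurwitz_swap _ _ _) (hurwitz_swap _ _ _).
apply: contra xyJ; rewrite porbit_sym => yb.
have bxH : b x \notin porbit H x.
  by rewrite bx refines_move //; apply/refinesX/refinesV.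
have XU : porbit H (b x) \in porbits U.
  apply: porbits_mul_tperm_notin; rewrite ?mem_porbits //.
    by rewrite porbit_sym.
  by rewrite porbit_sym -(porbit_eq xy).
rewrite (porbits_mem XU (porbit_id _ _)) in yb.
rewrite -(refines_move _ _ bJ); apply: porbit_trans (refines_porbit UJ yb) _.
by rewrite refines_move ?porbit_id.
Qed.

(* If tperm x y cuts a cycle D of H, then minimality of the genus makes
   H * tperm x y and A act separately on the two halves of D; pushing the
   transposition around the branch points of A moves one of its ends out of D. *)
Lemma joining_transposition H A x y w :
    x != y -> mulseq (H :: tperm x y :: A) = 1 ->
    connected (H :: tperm x y :: A) ->
    defect_sum (H :: tperm x y :: A) + 2 <= 2 * #|T| -> w \notin porbit H x ->
  exists x' y' A',
    hurwitz (tperm x y :: A) (tperm x' y' :: A') /\ x' \notin porbit H y'.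
Proof.
move=> nxy prod1 conn genus0 wx.
have [xy|xy] := boolP (x \in porbit H y); last first.
  by exists x, y, A; split=> //; apply: hurwitz_refl.
have [J []] := ree_inequality (H * tperm x y :: A).
have -> : mulseq (H * tperm x y :: A) = 1.
  by rewrite -prod1 !mulseq_cons mulgA.
rewrite defect_sum_cons defect1 addn0 => UAJ le_J.
have UJ : refines (H * tperm x y) J by apply: UAJ; rewrite mem_head.
(* The cut lowers the defect sum by 2: the transposition disappears and [H] loses one. If [x] and
   [y] shared a cycle of [J], connectedness would make [J] a full cycle, too large for Ree's
   bound. *)
have xyJ : y \notin porbit J x.
  apply/negP=> yxJ; have tJ : refines (tperm x y) J.
    by rewrite tpermC; apply: refines_tperm.
  have/card_porbits_full J1 : porbit J x = [set: T].
    apply: connected_porbit conn _ => s; rewrite !inE => /or3P[/eqP->|/eqP->//|sA].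
      by rewrite -(mulgK_tperm H x y); apply: refinesM.
    by apply: UAJ; rewrite inE sA orbT.
  have := defect_porbits J; rewrite !defect_sum_cons defect_tperm // in genus0.
  by have := defect_cut nxy xy; lia.
(* Some factor in [A] leaves the cycle of [H] through [x]; otherwise this cycle would be invariant
   under all factors, yet it misses [w]. *)
have [|/allPn[a aA]] := boolP (all (fun a : {perm T} => [forall (z | z \in porbit H
  x), a z \in porbit H x]) A).
  move/allP=> AH; have HT : porbit H x = [set: T].
    apply: conn; first by apply/set0Pn; exists x; apply: porbit_id.
    move=> s; rewrite !inE => /or3P[/eqP->|/eqP->|/AH/forall_inP sH].
    - exact/preserves_porbit/refines_refl.
    - exact/preserves_porbit/refines_tperm.
    - exact: preservesP.
  by rewrite HT inE in wx.
rewrite negb_forall_in => /exists_inP[z zH azH].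
have: (z \in porbit (H * tperm x y) x) || (z \in porbit (H * tperm x y) y).
  by apply: porbit_mul_tperm_sub; rewrite mulgK_tperm.
case/orP=> [zx|zy]; first exact: push_transposition prod1 xy UAJ xyJ aA zx azH.
rewrite tpermC in prod1 UAJ zy *.
apply: push_transposition prod1 _ UAJ _ aA zy _.
- by rewrite porbit_sym.
- by rewrite porbit_sym.
- by rewrite -(porbit_eq xy).
Qed.

(** Replacing [H] by its product with a joining transposition preserves the total product,
    connectedness and the defect sum, and uses up one transposition of [R]. *)
Lemma join_cycles n H R :
    #|porbits H| = n.+1 -> mulseq (H :: R) = 1 -> connected (H :: R) ->
    defect_sum (H :: R) + 2 <= 2 * #|T| ->
    n <= count (fun s => defect s == 1%N) R ->
  exists ts R', [/\ hurwitz R (ts ++ R'), size ts = n,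
    all (fun s => defect s == 1%N) ts & #|porbits (H * mulseq ts)| = 1%N].
Proof.
elim: n H R => [|n IHn] H R Hn prod1 conn genus0 le_n.
  by exists [::], R; split=> //; [exact: hurwitz_refl | rewrite mulseq0 mulg1].
have /hasP[t tR /eqP/defect1P[x [y [nxy tE]]]] : has (fun s => defect s == 1%N) R.
  by rewrite has_count; lia.
have [A RA] := hurwitz_mem_front tR; rewrite {t}tE in RA tR.
have HRA := hurwitz_cons H RA.
have [w wx] : exists w, w \notin porbit H x.
  apply/existsP; apply: contra_eqT Hn; rewrite negb_exists => /forallP Hx.
  rewrite (@card_porbits_full _ x) //; apply/setP=> w; rewrite inE.
  by have := Hx w; rewrite negbK.
have [x' [y' [A' [AA' xy']]]] : exists x' y' A',
    hurwitz (tperm x y :: A) (tperm x' y' :: A') /\ x' \notin porbit H y'.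
  apply: joining_transposition nxy _ _ _ wx.
  - by rewrite -(hurwitz_mulseq HRA).
  - exact: hurwitz_connected HRA conn.
  - by rewrite -(hurwitz_defect_sum HRA).
have RA' := hurwitz_trans RA AA'; have HRA' := hurwitz_cons H RA'.
set t := tperm x' y' in RA' HRA'.
have t1 : defect t = 1%N.
  by apply: defect_tperm; apply: contraNneq xy' => ->; apply: porbit_id.
have [|||||ts [R' [AR' ts_n ts1 full]]] := IHn (H * t) A'.
- have := defect_porbits H; have := defect_porbits (H * t).
  by rewrite defect_join // Hn; lia.
- by rewrite -prod1 (hurwitz_mulseq HRA') !mulseq_cons mulgA.
- move=> B B0 HA'B; apply: (hurwitz_connected HRA' conn) => // s.
  have HtB : preserves B (H * t) by apply: HA'B; rewrite mem_head.
  rewrite !inE => /or3P[/eqP->|/eqP->|sA'].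
  + exact: refines_preserves (refines_join xy') HtB.
  + exact: refines_preserves (refines_tperm (join_mem xy')) HtB.
  + by apply: HA'B; rewrite inE sA' orbT.
- by move: genus0; rewrite (hurwitz_defect_sum HRA') !defect_sum_cons defect_join //
    t1; lia.
- rewrite -ltnS; apply: (leq_trans le_n).
  have /seq.permP/(_ (pred1 1%N)) := hurwitz_defect RA'.
  by rewrite !count_map /= t1 add1n => ->.
exists (t :: ts), R'; split=> /=; rewrite ?ts_n ?t1 ?mulseq_cons ?mulgA //.
exact: hurwitz_trans RA' (hurwitz_cons t AR').
Qed.

End Joining.

(** * Minimal factorizations of a cycle into cycles *)

Section Cycles.

Local Open Scope group_scope.

Variable T : finType.
Implicit Types (s t u w c g z J : {perm T}) (x y v : T) (L : seq {perm T}).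

(** The identity qualifies, so that the empty product may remain after peeling; [proper_cycle]
    excludes it. *)
Definition one_cycle s := forall x y, s x != x -> s y != y -> y \in porbit s x.

Definition proper_cycle s := s != 1 /\ one_cycle s.

Lemma one_cycle1 : one_cycle 1.
Proof. by move=> x y; rewrite perm1 eqxx. Qed.

Lemma one_cycleJ s g : one_cycle s -> one_cycle (s ^ g).
Proof.
move=> sC x y; rewrite -[x](permKV g) -[y](permKV g) !permJ !(inj_eq perm_inj).
by move=> sx sy; rewrite porbitJ mem_imset ?sC //; apply: perm_inj.
Qed.

Lemma one_cycleV s : one_cycle s -> one_cycle s^-1.
Proof.
move=> sC x y sx sy; rewrite porbitV; apply: sC;
  last by rewrite -{2}[y](permKV s) (inj_eq perm_inj) eq_sym.
by rewrite -{2}[x](permKV s) (inj_eq perm_inj) eq_sym.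
Qed.

Lemma hurwitz_proper_cycle L1 L2 : hurwitz L1 L2 ->
  (forall s, s \in L1 -> proper_cycle s) -> forall s, s \in L2 -> proper_cycle s.
Proof.
move=> L12; apply: (hurwitz_all (K := proper_cycle) _ _ L12).1.
  by move=> s t [s1 sC] _; split; [rewrite conjg_eq1 | apply: one_cycleJ].
by move=> s [s1 sC]; split; [rewrite invg_eq1 | apply: one_cycleV].
Qed.

Lemma porbit_fix s x : s x = x -> porbit s x = [set x].
Proof.
move=> sx; apply/setP=> y; rewrite inE; apply/idP/eqP => [yx|->]; last exact: porbit_id.
apply/eqP; apply: (closed_porbit (B := pred1 x)) yx => [v|]; rewrite inE //.
by move/eqP->; rewrite inE sx.
Qed.

Lemma refines_fix s J x : refines s J -> J x = x -> s x = x.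
Proof. by move=> sJ Jx; have := sJ x; rewrite porbit_fix // inE => /eqP. Qed.

Lemma support_one_cycle s x : one_cycle s -> s x != x ->
  [set y | s y != y] = porbit s x.
Proof.
move=> sC sx; apply/setP=> y; rewrite inE; apply/idP/idP => [|yx]; first exact: sC.
by apply: contra sx => /eqP sy; move: yx; rewrite porbit_sym porbit_fix // inE =>
  /eqP->; apply/eqP.
Qed.

Lemma card_one_cycle s x : one_cycle s -> s x != x -> #|porbit s x| = (defect s).+1.
Proof.
move=> sC sx; have sE := support_one_cycle sC sx.
have porbitsE : porbits s = porbit s x |: [set [set y] | y in ~: porbit s x].
  apply/setP=> X; rewrite !inE; apply/imsetP/orP.
    case=> y _ ->; have [yx|yx] := boolP (y \in porbit s x).
      by left; rewrite (porbit_eq yx).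
    right; apply/imsetP; exists y; first by rewrite inE.
    by apply: porbit_fix; move: yx; rewrite -sE inE negbK => /eqP.
  case=> [/eqP->|/imsetP[y yx ->]]; first by exists x.
  by exists y => //; rewrite porbit_fix //; move: yx; rewrite inE -sE inE negbK => /eqP.
have := defect_porbits s; rewrite porbitsE cardsU1 card_imset; last exact: set1_inj.
have -> : porbit s x \notin [set [set y] | y in ~: porbit s x].
  apply/imsetP=> -[y yx xE]; move: yx; rewrite xE !inE eqxx.
  by [].
by have := cardsC (porbit s x); lia.
Qed.

Lemma minimal2 s t : defect s + defect t <= defect (s * t) ->
  refines s (s * t) /\ refines t (s * t).
Proof.
move=> st; have E : mulseq [:: s; t] = s * t by rewrite !mulseq_cons mulseq0 mulg1.
by split; rewrite -E; apply: minimal_refines; rewrite ?inE ?eqxx ?orbT //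
   !defect_sum_cons addn0 E.
Qed.

(** By minimality the cycles of [s] and [t] lie in cycles of the product, and the common point [x]
    puts them into the same one. *)
Lemma one_cycleM s t x : one_cycle s -> one_cycle t ->
  s x != x -> t x != x -> defect s + defect t <= defect (s * t) ->
  one_cycle (s * t).
Proof.
move=> sC tC sx tx /minimal2[sst tst].
suff st v : (s * t) v != v -> v \in porbit (s * t) x.
  by move=> v v' /st v1 /st v2; apply: porbit_trans v2 _; rewrite porbit_sym.
have [sv _|] := boolP (s v != v); first exact/(refines_porbit sst)/sC.
rewrite negbK permM => /eqP-> tv; exact/(refines_porbit tst)/tC.
Qed.

(** Otherwise the product agrees with [w] on the support of [w], which is then closed under it;
    being one cycle, the product moves no other point. By minimality the factors of [L] move only
    points that the product moves, hence points of [w]. *)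
Lemma touching_cycle w L :
    one_cycle w -> w != 1 -> L != [::] -> (forall s, s \in L -> s != 1) ->
    one_cycle (w * mulseq L) -> defect w + defect_sum L <= defect (w * mulseq L) ->
  exists2 c, c \in L & exists x, w x != x /\ c x != x.
Proof.
move=> wC w1 L0 L1 zC minL; set z := w * _ in zC minL.
have zE : mulseq (w :: L) = z by rewrite mulseq_cons.
have [|disj] := boolP (has (fun c : {perm T} => [exists x, (w x != x) && (c x != x)])
  L).
  by case/hasP=> c cL /existsP[x /andP[wx cx]]; exists c => //; exists x.
have fixV c x : c \in L -> w x != x -> c x = x.
  move=> cL wx; apply/eqP; apply: contraR disj => cx.
  by apply/hasP; exists c => //; apply/existsP; exists x; rewrite wx.
have wE x : w x != x -> z x = w x.
  move=> wx; rewrite permM; apply/eqP; rewrite -[_ == _]/(_ \in pred1 (w x)).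
  have : {subset L <= L} by []; elim: {-2}L => [|c M IHM] ML.
    by rewrite mulseq0 perm1 inE.
  rewrite mulseq_cons permM (fixV c (w x)) ?(inj_eq perm_inj) ?ML ?mem_head //.
  by apply: IHM => u uM; apply: ML; rewrite inE uM orbT.
have [x wx] := perm_neq1P w1.
have [c cL] : exists c, c \in L.
  by case: (L) L0 => // c M _; exists c; apply: mem_head.
have [v cv] := perm_neq1P (L1 c cL).
have zv : z v != v.
  apply: contra cv => /eqP zv; apply/eqP; apply: refines_fix zv.
  by rewrite -zE; apply: minimal_refines; rewrite ?zE // inE cL orbT.
have : v \in [pred y | w y != y].
  apply: (closed_porbit (s := z)) (zC x v _ zv) => [y|//|]; last by rewrite wE.
  by rewrite !inE => wy; rewrite wE // (inj_eq perm_inj).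
by rewrite inE => wv; rewrite (fixV c v) ?eqxx in cv.
Qed.

(** Factors that touch [w] are absorbed into it one by one, which keeps it a cycle, until a single
    factor [c] is left. *)
Lemma chain_cycles n w L :
    size L = n.+1 -> proper_cycle w -> (forall s, s \in L -> proper_cycle s) ->
    one_cycle (w * mulseq L) -> defect w + defect_sum L <= defect (w * mulseq L) ->
  exists L' c, hurwitz L (rcons L' c) /\ one_cycle (w * mulseq L').
Proof.
elim: n w L => [|n IHn] w L Ln [w1 wC] LC zC minL.
  case: L Ln LC zC minL => [|c []] // _ LC _ _.
  by exists [::], c; split; [apply: hurwitz_refl | rewrite mulseq0 mulg1].
have [||b bL [x [wx bx]]] := touching_cycle wC w1 _ _ zC minL.
- by case: (L) Ln.
- by move=> s /LC[].
have [b1 bC] := LC b bL.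
have [M LM] := hurwitz_mem_front bL.
have LE : mulseq L = b * mulseq M by rewrite (hurwitz_mulseq LM) mulseq_cons.
have dL : defect_sum L = defect b + defect_sum M.
  by rewrite (hurwitz_defect_sum LM) defect_sum_cons.
have dwb : defect w + defect b <= defect (w * b).
  have := defect_mul_le (w * b) (mulseq M); have := defect_prod_le M.
  move: minL; by rewrite LE dL mulpA; lia.
have wbC : one_cycle (w * b) by apply: one_cycleM wx bx dwb.
have wb1 : w * b != 1.
  by rewrite -defect_gt0; move: w1; rewrite -defect_gt0; lia.
have [|||||L' [c [MC wL']]] := IHn (w * b) M.
- by have := hurwitz_size LM; rewrite Ln => -[].
- by [].
- by move=> s sM; apply: (hurwitz_proper_cycle LM LC); rewrite inE sM orbT.
- by rewrite -mulpA -LE.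
- rewrite -mulpA -LE; move: minL; rewrite dL.
  by have := defect_mul_le w b; lia.
exists (b :: L'), c; rewrite mulseq_cons mulpA; split=> //.
exact: hurwitz_trans LM (hurwitz_cons b MC).
Qed.

Lemma minimal_hurwitz L1 L2 : hurwitz L1 L2 ->
  defect_sum L1 <= defect (mulseq L1) -> defect_sum L2 <= defect (mulseq L2).
Proof. by move=> L12; rewrite (hurwitz_defect_sum L12) (hurwitz_mulseq L12). Qed.

Lemma minimal_rcons L c :
    defect_sum (rcons L c) <= defect (mulseq (rcons L c)) ->
  defect_sum L <= defect (mulseq L) /\
  defect (mulseq L) + defect c <= defect (mulseq L * c).
Proof.
rewrite mulseq_rcons defect_sum_rcons => minL.
have := defect_prod_le L; have := defect_mul_le (mulseq L) c.
by split; lia.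
Qed.

Lemma mem_rconsE (L : seq {perm T}) c s : (s \in rcons L c) = (s == c) || (s \in L).
Proof. by rewrite mem_rcons inE. Qed.

(* Induction gives (.., c', c) with c' of defect e and w := mulseq (..) a cycle.
   A full twist of (c', c) rotates c until it meets w; then w * c is a cycle and
   c' can move past c. *)
Lemma peel_cycle n L e :
    size L = n -> (forall s, s \in L -> proper_cycle s) ->
    one_cycle (mulseq L) -> defect_sum L <= defect (mulseq L) ->
    e \in map (@defect T) L ->
  exists L' c, [/\ hurwitz L (rcons L' c), one_cycle (mulseq L') & defect c = e].
Proof.
elim: n L => [|n IHn] L Ln LC zC minL; first by case: L Ln LC zC minL.
case: L Ln LC zC minL => // a M [Mn] LC zC minL eL.
case: n Mn IHn => [|n] Mn IHn.
  case: M Mn LC zC minL eL => // _ _ _ _; rewrite inE => /eqP->.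
  exists [::], a; split=> //; first exact: hurwitz_refl.
  by rewrite mulseq0; apply: one_cycle1.
have [|||||N [c [MN NC]]] := @chain_cycles n a M.
- by [].
- by apply: LC; rewrite mem_head.
- by move=> s sM; apply: LC; rewrite inE sM orbT.
- by rewrite -mulseq_cons.
- by rewrite -mulseq_cons -defect_sum_cons.
have LN := hurwitz_cons a MN; rewrite -rcons_cons in LN; rewrite -mulseq_cons in NC.
have aNn : size (a :: N) = n.+1.
  by have := hurwitz_size LN; rewrite size_rcons /= Mn; lia.
set K := a :: N in LN NC aNn; have LCK := hurwitz_proper_cycle LN LC.
have [minK minKc] := minimal_rcons (minimal_hurwitz LN minL).
have [ce|ce] := eqVneq (defect c) e; first by exists K, c.
have eK : e \in map (@defect T) K.
  move: eL; rewrite (perm_mem (hurwitz_defect LN)) map_rcons mem_rcons inE.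
  by rewrite eq_sym (negPf ce).
have KC s : s \in K -> proper_cycle s by move=> sK; apply: LCK;
  rewrite mem_rconsE sK orbT.
have [N' [c' [KN' N'C c'e]]] := IHn K aNn KC NC minK eK.
have LN' := hurwitz_trans LN (hurwitz_rcons c KN').
have [c1 cC] : proper_cycle c by apply: LCK; rewrite mem_rconsE eqxx.
have N'P := hurwitz_proper_cycle KN' KC.
have [c'1 c'C] : proper_cycle c' by apply: N'P; rewrite mem_rconsE eqxx.
have KE : mulseq K = mulseq N' * c' by rewrite (hurwitz_mulseq KN') mulseq_rcons.
have [minN' minN'c'] := minimal_rcons (minimal_hurwitz KN' minK).
have zE : mulseq (a :: M) = mulseq N' * (c' * c).
  by rewrite (hurwitz_mulseq LN') !mulseq_rcons mulpA.
suff [i] : exists i, one_cycle (mulseq N' * c ^ ((c' * c) ^+ i)).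
  set p := c' * c; set g := p ^+ i => wcC.
  exists (rcons N' (c ^ g)), ((c' ^ g) ^ (c ^ g)); split; last by rewrite !defectJ.
    apply: hurwitz_trans LN' _; rewrite -!cats1 -!catA /=.
    apply: hurwitz_catl; apply: hurwitz_trans (hurwitz_swap _ _ _).
    have := hurwitz_twist [:: c'; c] i.
    by rewrite !mulseq_cons mulseq0 mulg1.
  by rewrite mulseq_rcons.
have [N'0|N'0] := eqVneq N' [::].
  by exists 0; rewrite N'0 mulseq0 mul1g conjg1.
set w := mulseq N' in zE N'C minN' minN'c' KE *.
have w1 : w != 1.
  rewrite -defect_gt0; case: (N') N'0 minN' N'P => // s N2 _ minN' N'P.
  have [s1 _] : proper_cycle s by apply: N'P; rewrite mem_head.
  by move: s1; rewrite -defect_gt0; move: minN'; rewrite defect_sum_cons; lia.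
have minwc'c : defect w + defect c' + defect c <= defect (w * c' * c).
  by move: minKc; rewrite KE; lia.
have minc'c : defect c' + defect c <= defect (c' * c).
  by have := defect_mul_le w (c' * c); rewrite mulpA; lia.
have minwci i : defect w + defect (c ^ ((c' * c) ^+ i)) <= defect (w * c ^ ((c' * c)
  ^+ i)).
  have := hurwitz_twist [:: c'; c] i; rewrite !mulseq_cons mulseq0 mulg1 /= => tw.
  have := hurwitz_trans tw (hurwitz_swap _ _ _); set g := _ ^+ i => /hurwitz_mulseq.
  rewrite !mulseq_cons mulseq0 !mulg1 => E.
  have := defect_mul_le (w * c ^ g) ((c' ^ g) ^ (c ^ g)).
  by rewrite -mulpA -E mulpA !defectJ; lia.
(* If [c'] and [c] meet, their product is a cycle, and a power of it carries a point of [c] to a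
   point of [w]. If they are disjoint, [c'] fixes the point where [c] meets [w * c'], so [c] already
   meets [w] there. *)
have [/existsP[v /andP[c'v cv]]|disj] := boolP [exists v, (c' v != v) && (c v != v)].
  have pC := one_cycleM c'C cC c'v cv minc'c.
  have [c'p cp] := minimal2 minc'c.
  have [|||b bL [x [wx bx]]] := @touching_cycle w [:: c'; c] N'C w1 isT.
  - by move=> s; rewrite !inE => /orP[] /eqP->.
  - by rewrite !mulseq_cons mulseq0 mulg1 -zE.
  - by rewrite !mulseq_cons mulseq0 mulg1 !defect_sum_cons mulpA /defect_sum /=; lia.
  have px : (c' * c) x != x.
    apply: contra bx => /eqP px; apply/eqP; apply: refines_fix px.
    by move: bL; rewrite !inE => /orP[] /eqP->.
  have pv : (c' * c) v != v.
    by apply: contra cv => /eqP pv; apply/eqP; apply: refines_fix pv.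
  have /porbitP[i xE] := pC v x pv px; exists i.
  apply: one_cycleM N'C _ wx _ (minwci i); first exact: one_cycleJ.
  by rewrite xE permJ (inj_eq perm_inj).
exists 0; rewrite conjg1.
have [|||||b] := @touching_cycle (w * c') [:: c] _ _ isT.
- by rewrite -KE.
- by rewrite -defect_gt0; move: w1; rewrite -defect_gt0; lia.
- by move=> s; rewrite inE => /eqP->.
- by rewrite mulseq_cons mulseq0 mulg1 -mulpA -zE.
- by rewrite mulseq_cons mulseq0 mulg1 defect_sum_cons /defect_sum /=;
    have := defect_mul_le w c'; lia.
rewrite inE => /eqP-> [x [wcx cx]].
have c'x : c' x = x.
  by apply/eqP; apply: contraR disj => c'x; apply/existsP; exists x; rewrite c'x.
have wx : w x != x.
  by apply: contra wcx => /eqP wx; rewrite permM wx c'x.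
by have := minwci 0; rewrite conjg1; apply: one_cycleM wx cx.
Qed.

(** The cycle through [x] has [(defect s).+1] points, so the range [i <= defect s] runs through all
    of it. *)
Lemma eq_traject_cycle s t x :
    one_cycle s -> one_cycle t -> s x != x -> t x != x -> defect s = defect t ->
    (forall i, i <= defect s -> (s ^+ i) x = (t ^+ i) x) ->
  s = t.
Proof.
move=> sC tC sx tx st E.
have Es := card_one_cycle sC sx; have Et := card_one_cycle tC tx.
have mem u y : u x != x -> one_cycle u -> defect u = defect s ->
    u y != y -> exists2 i, i <= defect s & y = (u ^+ i) x.
  move=> ux uC us uy; have := uC x y ux uy.
  rewrite porbit_traject card_one_cycle // us => /trajectP[i le_i ->].
  by exists i; rewrite ?permX.
have iterE u : u x != x -> one_cycle u -> defect u = defect s -> (u ^+ (defect s).+1)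
  x = x.
  by move=> ux uC us; rewrite permX -us -(card_one_cycle uC ux) iter_porbit.
have step i : i <= defect s -> s ((s ^+ i) x) = t ((t ^+ i) x).
  move=> le_i; rewrite -!permM -!expgSr; move: le_i; rewrite leq_eqVlt.
  by case/predU1P=> [->|/E//]; rewrite !iterE.
apply/permP=> y; have [sy|] := boolP (s y != y).
  by have [i le_i ->] := mem s y sx sC erefl sy; rewrite {2}E // step.
rewrite negbK => /eqP sy; apply/eqP; rewrite sy eq_sym; apply: contraT => ty.
have [i le_i yE] := mem t y tx tC (esym st) ty.
have := step i le_i; rewrite E // -yE sy => tyE.
by rewrite -tyE eqxx in ty.
Qed.

(** For [w != 1], the supports of [w] and [c] have [defect w + defect c + 2] points together and
    cover the support of [z], which has at least one point fewer than that; hence they share only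
    one point. Elsewhere on its support [c] agrees with [z], so the two trajectories starting just
    after the shared point agree until [c] returns to it. *)
Lemma minimal_cycle_traject w c z :
    one_cycle w -> one_cycle c -> c != 1 -> w * c = z -> one_cycle z ->
    defect w + defect c <= defect z ->
  exists2 x, c x != x & forall i, i <= defect c -> (c ^+ i) x = (z ^+ i) x.
Proof.
move=> wC cC c1 wcz zC minz; have [v cv] := perm_neq1P c1.
have [w1|w1] := eqVneq w 1.
  by exists v => // i _; rewrite -wcz w1 mul1g.
have cE : mulseq [:: c] = c by rewrite mulseq_cons mulseq0 mulg1.
have [|||b] := @touching_cycle w [:: c] wC w1 isT.
- by move=> s; rewrite inE => /eqP->.
- by rewrite cE wcz.
- by rewrite cE wcz defect_sum_cons addn0.
rewrite inE => /eqP-> [x [wx cx]].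
have meet1 y : w y != y -> c y != y -> y = x.
  move=> wy cy; have [wz cz] : refines w (w * c) /\ refines c (w * c) by apply:
    minimal2; rewrite wcz.
  have zx : z x != x.
    by apply: contra cx => /eqP zx; apply/eqP; apply: refines_fix zx; rewrite -wcz.
  have: #|[set u | w u != u] :&: [set u | c u != u]| <= 1.
    have := cardsUI [set u | w u != u] [set u | c u != u].
    have /subset_leq_card : [set u | z u != u] \subset [set u | w u != u] :|: [set u
      | c u != u].
      apply/subsetP=> u; rewrite !inE; apply: contraR; rewrite negb_or !negbK.
      by case/andP=> /eqP wu /eqP cu; rewrite -wcz permM wu cu.
    rewrite (support_one_cycle wC wx) (support_one_cycle cC cx) (support_one_cycle zC
      zx).
    by rewrite !card_one_cycle //; lia.
  by move/card_le1_eqP; apply; rewrite !inE ?wy ?wx.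
exists (c x); first by rewrite (inj_eq perm_inj).
have cr := card_one_cycle cC cx.
elim=> [|i IHi] le_i; first by rewrite !perm1.
rewrite !expgSr !permM -IHi; last exact: ltnW.
set y := (c ^+ i) _; have yE : y = iter i.+1 c x by rewrite /y permX iterSr.
have yx : y != x.
  have := uniq_traject_porbit c x; rewrite cr /= => /andP[+ _].
  apply: contraNneq => yx; apply/trajectP; exists i => //.
  by rewrite -iterSr -yE yx.
have cy : c y != y.
  have : y \in [set u | c u != u] by rewrite (support_one_cycle cC cx) yE -permX
    mem_porbit.
  by rewrite inE.
by rewrite -wcz permM; congr (c _); apply/esym/eqP; apply: contraR yx => wy;
  rewrite (meet1 y).
Qed.

(** Both last factors follow [z] along stretches of equal length, and a power of the cycle [z]
    carries the start of one stretch to the start of the other. *)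
Lemma minimal_cycle_unique w c w' c' z :
    one_cycle w -> one_cycle c -> one_cycle w' -> one_cycle c' -> one_cycle z ->
    w * c = z -> w' * c' = z -> defect c = defect c' -> c != 1 ->
    defect w + defect c <= defect z -> defect w' + defect c' <= defect z ->
  exists i, c' = c ^ (z ^+ i).
Proof.
move=> wC cC w'C c'C zC wcz w'cz dcc' c1 minz minz'.
have c'1 : c' != 1 by rewrite -defect_gt0 -dcc' defect_gt0.
have [x cx cE] := minimal_cycle_traject wC cC c1 wcz zC minz.
have [x' c'x' c'E] := minimal_cycle_traject w'C c'C c'1 w'cz zC minz'.
have moved v s : s v != v -> (forall i, i <= defect s -> (s ^+ i) v = (z ^+ i) v) ->
    s != 1 -> z v != v.
  by move=> sv E; rewrite -defect_gt0 => /E; rewrite !expg1 => <-.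
have /porbitP[i x'E] := zC x x' (moved _ _ cx cE c1) (moved _ _ c'x' c'E c'1).
exists i; apply/esym; apply: (@eq_traject_cycle _ _ x') => //.
- exact: one_cycleJ.
- by rewrite x'E permJ (inj_eq perm_inj).
- by rewrite defectJ.
move=> j; rewrite defectJ => le_j; rewrite -conjXg c'E -?dcc' // x'E permJ cE //.
by rewrite -!permM -!expgD addnC.
Qed.

Theorem hurwitz_cycles n L1 L2 :
    size L1 = n -> (forall s, s \in L1 -> proper_cycle s) ->
    (forall s, s \in L2 -> proper_cycle s) ->
    perm_eq (map (@defect T) L1) (map (@defect T) L2) ->
    mulseq L1 = mulseq L2 -> one_cycle (mulseq L1) ->
    defect_sum L1 <= defect (mulseq L1) ->
  hurwitz L1 L2.
Proof.
elim: n L1 L2 => [|n IHn] L1 L2 L1n L1C L2C dL12 z12 zC min1.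
  case: L1 L1n {L1C z12 zC min1} dL12 => // _ /perm_size; rewrite size_map /=.
  by case: L2 {L2C} => // _; apply: hurwitz_refl.
have [e eL1] : exists e, e \in map (@defect T) L1.
  by case: (L1) L1n => // s L _; exists (defect s); apply: mem_head.
have min2 : defect_sum L2 <= defect (mulseq L2).
  by rewrite -z12 /defect_sum -(perm_sumn dL12).
have [M1 [c1 [LM1 M1C c1e]]] := peel_cycle L1n L1C zC min1 eL1.
have L2n : size L2 = n.+1.
  by have := perm_size dL12; rewrite !size_map L1n => ->.
have [M2 [c2 [LM2 M2C c2e]]] : exists L' c, [/\ hurwitz L2 (rcons L' c), one_cycle
  (mulseq L') & defect c = e].
  by apply: peel_cycle L2n L2C _ min2 _; rewrite -?z12 // -(perm_mem dL12).
have P1 := hurwitz_proper_cycle LM1 L1C; have P2 := hurwitz_proper_cycle LM2 L2C.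
have [c1_1 c1C] : proper_cycle c1 by apply: P1; rewrite mem_rconsE eqxx.
have [_ c2C] : proper_cycle c2 by apply: P2; rewrite mem_rconsE eqxx.
have [minM1 minM1c] := minimal_rcons (minimal_hurwitz LM1 min1).
have [minM2 minM2c] := minimal_rcons (minimal_hurwitz LM2 min2).
have E1 : mulseq M1 * c1 = mulseq L1 by rewrite (hurwitz_mulseq LM1) mulseq_rcons.
have E2 : mulseq M2 * c2 = mulseq L1 by rewrite z12 (hurwitz_mulseq LM2) mulseq_rcons.
have [|||i c2E] := minimal_cycle_unique M1C c1C M2C c2C zC E1 E2 _ c1_1.
- by rewrite c1e.
- by rewrite -E1.
- by rewrite -E2.
set g := mulseq L1 ^+ i in c2E.
have L1g : hurwitz L1 (rcons (conjseq M1 g) c2).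
  rewrite c2E -conjseq_rcons; apply: hurwitz_trans (hurwitz_twist L1 i) _.
  exact: hurwitz_conj.
apply: (hurwitz_trans L1g); apply: hurwitz_sym; apply: (hurwitz_trans LM2).
apply: hurwitz_rcons; apply: hurwitz_sym.
have zg : mulseq (conjseq M1 g) = mulseq M2.
  by apply: (mulIg c2); rewrite E2 -mulseq_rcons -(hurwitz_mulseq L1g).
have Pg := hurwitz_proper_cycle L1g L1C.
apply: IHn => //.
- by have := hurwitz_size L1g; rewrite L1n size_rcons => -[].
- by move=> s sM; apply: Pg; rewrite mem_rconsE sM orbT.
- by move=> s sM; apply: P2; rewrite mem_rconsE sM orbT.
- have := perm_trans (hurwitz_defect (hurwitz_sym L1g)) (perm_trans dL12
    (hurwitz_defect LM2)).
  by rewrite !map_rcons perm_rcons perm_sym perm_rcons perm_cons perm_sym.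
- by rewrite zg.
- by have [] := minimal_rcons (minimal_hurwitz L1g min1).
Qed.

End Cycles.

(** * Minimal factorizations with one arbitrary factor *)

Section Leaves.

Local Open Scope group_scope.

Variable T : finType.
Implicit Types (s t u w c g h z J : {perm T}) (x y v : T) (L ts : seq {perm T}).
Implicit Types (A B X Y : {set T}).

Lemma imset_perm1 A : (1 : {perm T}) @: A = A.
Proof. by rewrite -[RHS]imset_id; apply: eq_imset => x; rewrite perm1. Qed.

Lemma imset_permM g h A : (g * h) @: A = h @: (g @: A).
Proof. by rewrite -imset_comp; apply: eq_imset => x; rewrite permM. Qed.

Lemma imset_porbit g J Y : refines g J -> Y \in porbits J -> g @: Y = Y.
Proof.
move=> gJ /imsetP[x _ ->]; apply/eqP; rewrite eqEcard card_imset ?leqnn ?andbT;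
  last exact: perm_inj.
by apply/subsetP=> _ /imsetP[y yx ->]; rewrite refines_move.
Qed.

Lemma imset_porbits s g Y : Y \in porbits s -> g @: Y \in porbits (s ^ g).
Proof. by move=> Ys; rewrite porbitsJ imset_f. Qed.

Lemma porbit_subset s J X A x : refines s J -> X \in porbits J -> A \in porbits s ->
  x \in A -> x \in X -> A \subset X.
Proof.
move=> sJ XJ As xA xX; rewrite (porbits_mem XJ xX) (porbits_mem As xA).
by apply/subsetP=> y; apply: refines_porbit.
Qed.

Lemma minimal_notin z x y : x != y ->
  defect z + defect (tperm x y) <= defect (z * tperm x y) -> x \notin porbit z y.
Proof.
by move=> nxy; rewrite defect_tperm //; apply: contraTN => xy;
  have := defect_cut nxy xy; lia.
Qed.

(* By induction A is cut off by the last transposition but one, inside a cycle Z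
   of the product z of all but the last.  A full twist of the factors of z
   rotates A inside Z off both ends of the last transposition, and then the
   transposition cutting off A can be moved last. *)
Lemma peel_leaf n h ts A :
    size ts = n -> all (fun s => defect s == 1%N) ts ->
    defect_sum (h :: ts) <= defect (mulseq (h :: ts)) ->
    A \in porbits h -> A \notin porbits (mulseq (h :: ts)) ->
  exists g ts' t, [/\ refines g (mulseq (h :: ts)),
    hurwitz (h :: ts) (h ^ g :: rcons ts' t),
    all (fun s => defect s == 1%N) (rcons ts' t)
    & g @: A \in porbits (mulseq (h ^ g :: ts'))].
Proof.
elim: n ts => [|n IHn] ts.
  by case: ts => // _ _ _ Ah; rewrite mulseq_cons mulseq0 mulg1 Ah.
case/lastP: ts => // ts t0; rewrite size_rcons all_rcons => -[ts_n] /andP[/eqP t0_1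
  ts1].
rewrite -rcons_cons => minL Ah Az; have [minz minzt] := minimal_rcons minL.
have [x [y [nxy t0E]]] := defect1P t0_1.
rewrite mulseq_rcons in Az *; set z := mulseq (h :: ts) in minz minzt Az *.
have xyz : x \notin porbit z y by apply: minimal_notin; rewrite -?t0E.
have zzt : refines z (z * t0) by rewrite t0E; apply: refines_join.
have [Az'|Az'] := boolP (A \in porbits z).
  exists 1, ts, t0; rewrite conjg1 imset_perm1 all_rcons t0_1 ts1; split=> //.
    exact: refines1.
  exact: hurwitz_refl.
have [g1 [ts1' [t [g1z LM tsC Bw]]]] := IHn ts ts_n ts1 minz Ah Az'.
set B := g1 @: A in Bw; set w := mulseq _ in Bw.
have wtz : w * t = z by rewrite /z (hurwitz_mulseq LM) -rcons_cons mulseq_rcons.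
have wz : refines w z.
  have [|wz _] := @minimal2 _ w t; last by rewrite -wtz.
  by have [] := minimal_rcons (L := _ :: _) (minimal_hurwitz LM minz).
have [v vB] : exists v, v \in B by case/imsetP: Bw => v _ ->; exists v;
  apply: porbit_id.
have BZ : B \subset porbit z v.
  exact: porbit_subset wz (mem_porbits _ _) Bw vB (porbit_id _ _).
(* The conjugator [g1] preserves each cycle of [z], so [B] could fill its cycle only if [A] were
   itself a cycle of [z]. *)
have [v' v'Z v'B] : exists2 v', v' \in porbit z v & v' \notin B.
  apply/subsetPn; apply: contra Az' => ZB.
  have BE : B = porbit z v by apply/eqP; rewrite eqEsubset BZ ZB.
  have <- : B = A; last by rewrite BE mem_porbits.
  have g1V : g1^-1 @: B = B.
    by apply: imset_porbit (refinesV g1z) _; rewrite BE mem_porbits.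
  by rewrite -g1V -imset_permM mulgV imset_perm1.
(* Since [x] and [y] lie in different cycles of [z], at most one of them lies in the cycle
   containing [B]. Rotations of [B] stay in this cycle, and some rotation of the proper subset [B]
   avoids that end. *)
have outside y0 : y0 \notin porbit z v -> forall j, y0 \notin (z ^+ j) @: B.
  move=> y0Z j; apply: contra y0Z => /imsetP[u uB ->].
  by rewrite refines_move ?(subsetP BZ) //; apply/refinesX/refines_refl.
have inside x0 : x0 \in porbit z v -> exists j, x0 \notin (z ^+ j) @: B.
  move=> x0Z; have /porbitP[j x0E] : x0 \in porbit z v'.
    by apply: porbit_trans x0Z _; rewrite porbit_sym.
  by exists j; rewrite x0E mem_imset //; apply: perm_inj.
have [j xj yj] : exists2 j, x \notin (z ^+ j) @: B & y \notin (z ^+ j) @: B.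
  have [xZ|xZ] := boolP (x \in porbit z v).
    have [j xj] := inside x xZ; exists j => //; apply: outside.
    by apply: contra xyz => yZ; apply: porbit_trans xZ _; rewrite porbit_sym.
  have [yZ|yZ] := boolP (y \in porbit z v); last by exists 0; apply: outside.
  by have [j yj] := inside y yZ; exists j => //; apply: outside.
set g2 := z ^+ j in xj yj.
exists (g1 * g2), (rcons (conjseq ts1' g2) t0), ((t ^ g2) ^ t0); split.
- apply: refinesM; first exact: refines_trans zzt.
  exact: refinesX.
- have tw := hurwitz_trans LM (hurwitz_twist _ j).
  rewrite -(hurwitz_mulseq LM) -/z -/g2 in tw.
  apply: hurwitz_trans (hurwitz_rcons t0 tw) _.
  rewrite conjgM /= conjseq_rcons -!cats1 -!catA /=.
  exact: (hurwitz_step (_ :: _)).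
- rewrite !all_rcons !defectJ t0_1 /=; move: tsC; rewrite all_rcons => /andP[-> ts1'1].
  by rewrite all_map; apply: sub_all ts1'1 => s /=; rewrite defectJ.
rewrite -rcons_cons mulseq_rcons t0E imset_permM.
apply: porbits_mul_tperm_notin => //.
have -> : mulseq (h ^ (g1 * g2) :: conjseq ts1' g2) = w ^ g2.
  by rewrite -mulseq_conj /= conjgM.
exact: imset_porbits.
Qed.

(** By minimality [t] has one end [x] in [B] and the other outside. From [x] the product runs
    through [B] as [z] does, and the step that would close the cycle lands on the other end. Thus
    the product, [#|B|] and [x] determine [t]. *)
Lemma leaf_transposition z t B :
    defect t = 1%N -> defect z + defect t <= defect (z * t) ->
    B \in porbits z -> B \notin porbits (z * t) ->
  exists2 x, x \in B & t = tperm x (((z * t) ^+ #|B|) x).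
Proof.
move=> t1 minzt Bz Bzt; have [x [y [nxy tE]]] := defect1P t1.
have {Bzt} : (x \in B) || (y \in B).
  by apply: contraR Bzt; rewrite negb_or tE => /andP[]; apply: porbits_mul_tperm_notin.
wlog xB : x y nxy tE / x \in B.
  move=> IH /orP[xB|yB]; first by apply: (IH x y); rewrite ?xB.
  by apply: (IH y x); rewrite ?yB 1?eq_sym 1?tpermC.
move=> _; exists x => //; suff yE : ((z * t) ^+ #|B|) x = y by rewrite yE.
have BE := porbits_mem Bz xB.
have xyz : x \notin porbit z y by apply: minimal_notin; rewrite -?tE.
have B0 : 0 < #|B| by apply/card_gt0P; exists x.
have zS i : z ((z ^+ i) x) = (z ^+ i.+1) x by rewrite expgSr permM.
have E i : i < #|B| -> ((z * t) ^+ i) x = (z ^+ i) x.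
  elim: i => [|i IHi] lt_i; first by rewrite !perm1.
  rewrite expgSr permM IHi ?(ltnW lt_i) // permM zS tE tpermD //.
    have := uniq_traject_porbit z x; rewrite -BE; case: (#|B|) lt_i => // m lt_i.
    move=> /= /andP[+ _]; apply: contraNneq => xi; apply/trajectP; exists i => //.
    by rewrite -iterSr -permX.
  by apply: contraNneq xyz => ->; rewrite porbit_sym mem_porbit.
rewrite -(prednK B0) expgSr permM E ?prednK // permM zS prednK //.
by rewrite permX {1}BE iter_porbit tE tpermL.
Qed.

(** The cycle type as a multiplicity function, available over any finite type. *)
Definition cycle_count s k := #|[set A in porbits s | #|A| == k]|.

Lemma cycle_countJ s g k : cycle_count (s ^ g) k = cycle_count s k.
Proof.
rewrite /cycle_count porbitsJ -[RHS](card_imset _ (imset_inj (@perm_inj _ g))).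
congr #|pred_of_set _|; apply/setP=> A; rewrite inE; apply/andP/imsetP.
  case=> /imsetP[B Bs ->] gBk; exists B => //.
  by rewrite inE Bs -(card_imset _ (@perm_inj _ g)).
case=> B; rewrite inE => /andP[Bs Bk] ->.
by rewrite card_imset ?imset_f //; apply: perm_inj.
Qed.

(** The second summand does not depend on [h]; hence two permutations with equal cycle counts also
    have equal counts inside [X]. *)
Lemma cycle_count_in h z X k :
    refines h z -> X \in porbits z ->
    (forall Y, Y \in porbits z -> Y != X -> Y \in porbits h) ->
  cycle_count h k = #|[set A in porbits h | (#|A| == k) && (A \subset X)]|
                    + #|[set Y in porbits z | (#|Y| == k) && (Y != X)]|.
Proof.
move=> hz Xz zh; rewrite /cycle_count -(cardsID [set A : {set T} | A \subset X]).
congr (_ + _); apply: eq_card => A; rewrite !inE; first by rewrite andbA.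
apply/and3P/and3P => [[AX Ah Ak]|[Az Ak AX]].
  have /imsetP[v _ AE] := Ah.
  have vX : v \notin X.
    by apply: contra AX => vX; apply: porbit_subset hz Xz Ah _ vX; rewrite AE porbit_id.
  have vzX : porbit z v != X by apply: contraNneq vX => <-; apply: porbit_id.
  have -> : A = porbit z v.
    by rewrite AE (porbits_mem (zh _ (mem_porbits _ _) vzX) (porbit_id _ _)).
  by split=> //; [apply: mem_porbits | rewrite (porbits_mem (zh _ (mem_porbits _ _)
    vzX) (porbit_id _ _)) -AE].
split=> //; last exact: zh.
have /imsetP[v _ AE] := Az; apply: contra AX => AX.
rewrite (porbits_mem Xz (subsetP AX v _)) AE ?porbit_id //.
Qed.

(** Peeling off a transposition splits a cycle of the product, so the induction must allow several
    cycles. All of them except [X] are already cycles of both [h1] and [h2]; each peeled leaf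
    becomes one of these. *)
Theorem hurwitz_transpositions n h1 ts1 h2 ts2 z X :
    size ts1 = n -> size ts2 = n ->
    all (fun s => defect s == 1%N) ts1 -> all (fun s => defect s == 1%N) ts2 ->
    mulseq (h1 :: ts1) = z -> mulseq (h2 :: ts2) = z ->
    defect_sum (h1 :: ts1) <= defect z -> defect_sum (h2 :: ts2) <= defect z ->
    X \in porbits z ->
    (forall Y, Y \in porbits z -> Y != X -> (Y \in porbits h1) && (Y \in porbits h2)) ->
    cycle_count h1 =1 cycle_count h2 ->
  hurwitz (h1 :: ts1) (h2 :: ts2).
Proof.
elim: n h1 ts1 h2 ts2 z X => [|n IHn] h1 ts1 h2 ts2 z X.
  move=> /size0nil-> /size0nil->; rewrite !mulseq_cons mulseq0 !mulg1 => _ _ -> -> _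
    _ _ _ _.
  exact: hurwitz_refl.
move=> ts1n ts2n ts1_1 ts2_1 z1 z2 min1 min2 Xz zh cc.
have zh1 Y : Y \in porbits z -> Y != X -> Y \in porbits h1 by move=> Yz /(zh Y
  Yz)/andP[].
have zh2 Y : Y \in porbits z -> Y != X -> Y \in porbits h2 by move=> Yz /(zh Y
  Yz)/andP[].
have h1z : refines h1 z by rewrite -z1; apply: minimal_refines; rewrite ?z1 ?mem_head.
have h2z : refines h2 z by rewrite -z2; apply: minimal_refines; rewrite ?z2 ?mem_head.
have [x0 x0X] : exists x0, x0 \in X by case/imsetP: Xz => x0 _ ->; exists x0;
  apply: porbit_id.
have Ah1 := mem_porbits h1 x0; set A1 := porbit h1 x0 in Ah1.
have A1X : A1 \subset X by apply: porbit_subset h1z Xz Ah1 (porbit_id _ _) x0X.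
(* Otherwise every cycle of [z] would be a cycle of [h1], which leaves no defect for the
   transpositions. *)
have A1X' : A1 != X.
  apply/eqP=> A1E; suff /refines_defect : refines z h1.
    by move: min1; rewrite defect_sum_cons /defect_sum;
      case: (ts1) ts1n ts1_1 => //= s L _ /andP[/eqP-> _]; lia.
  move=> v; have [vX|vX] := eqVneq (porbit z v) X.
    have vA1 : v \in A1 by rewrite A1E -vX porbit_id.
    by rewrite -(porbits_mem Ah1 vA1) A1E -vX porbitM.
  have vh1 := zh1 _ (mem_porbits _ _) vX.
  by rewrite -(porbits_mem vh1 (porbit_id _ _)) porbitM.
have A1z : A1 \notin porbits z.
  apply: contra A1X' => A1z; apply/eqP.
  by rewrite (porbits_mem A1z (porbit_id _ _)) (porbits_mem Xz x0X).
have ltA1 : #|A1| < #|X|.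
  by apply: proper_card; rewrite properEneq A1X' A1X.
have [A2 [Ah2 A2X A2A1]] : exists A2, [/\ A2 \in porbits h2, A2 \subset X & #|A2| =
  #|A1|].
  have := cc #|A1|; rewrite (cycle_count_in _ h1z Xz zh1) (cycle_count_in _ h2z Xz zh2).
  move/addIn => E; have : 0 < #|[set A in porbits h2 | (#|A| == #|A1|) && (A \subset
    X)]|.
    by rewrite -E; apply/card_gt0P; exists A1; rewrite inE Ah1 eqxx.
  by case/card_gt0P=> A2; rewrite inE => /and3P[? /eqP ? ?]; exists A2.
have A2z : A2 \notin porbits z.
  apply/negP=> A2z; have /imsetP[v _ vE] := A2z.
  have vA2 : v \in A2 by rewrite vE porbit_id.
  suff A2E : A2 = X by move: ltA1; rewrite -A2E A2A1 ltnn.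
  by rewrite (porbits_mem A2z vA2) (porbits_mem Xz (subsetP A2X v vA2)).
have leaf h ts A : size ts = n.+1 -> all (fun s => defect s == 1%N) ts ->
    mulseq (h :: ts) = z -> defect_sum (h :: ts) <= defect z ->
    A \in porbits h -> A \notin porbits z -> A \subset X -> #|A| = #|A1| ->
  exists g us x, let t := tperm x ((z ^+ #|A1|) x) in
    [/\ refines g z /\ hurwitz (h :: ts) (h ^ g :: rcons us t),
        size us = n /\ all (fun s => defect s == 1%N) us,
        defect_sum (h ^ g :: us) <= defect (mulseq (h ^ g :: us)),
        x \in g @: A & [/\ x \in X, mulseq (h ^ g :: us) * t = z, g @: A \in porbits
          (mulseq (h ^ g :: us)) & defect t = 1%N]].
  move=> tsn ts_1 zE minL Ah Az AX AA1.
  have minL' : defect_sum (h :: ts) <= defect (mulseq (h :: ts)) by rewrite zE.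
  have Az' : A \notin porbits (mulseq (h :: ts)) by rewrite zE.
  have [g [us [t [gz LM us1 gA]]]] := peel_leaf tsn ts_1 minL' Ah Az'.
  rewrite zE in gz; set w := mulseq (h ^ g :: us) in gA *.
  have wt : w * t = z by rewrite -zE (hurwitz_mulseq LM) -rcons_cons mulseq_rcons.
  have [minw minwt] := minimal_rcons (L := _ :: _) (minimal_hurwitz LM minL').
  move: us1; rewrite all_rcons => /andP[/eqP t1 us1].
  have gAz : g @: A \notin porbits (w * t).
    apply: contra Az => gAz; rewrite wt in gAz; have := imset_porbit (refinesV gz) gAz.
    by rewrite -imset_permM mulgV imset_perm1 => ->.
  have [x xgA tE] := leaf_transposition t1 minwt gA gAz.
  have tE' : t = tperm x ((z ^+ #|A1|) x).
    by rewrite {1}tE wt card_imset ?AA1 //; apply: perm_inj.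
  exists g, us, x; rewrite /= -tE'; split=> //.
    split=> //; have := hurwitz_size LM; rewrite /= size_rcons tsn => -[].
    by [].
  split=> //; case/imsetP: xgA => v vA ->.
  have /imsetP[x1 _ X1E] := Xz; rewrite X1E refines_move // -X1E.
  exact: (subsetP AX).
have [g1 [us1 [x1 []]]] := leaf h1 ts1 A1 ts1n ts1_1 z1 min1 Ah1 A1z A1X erefl.
set t1 := tperm _ _ => -[g1z LM1] [us1n us1_1] minM1 x1A [x1X w1z g1A t1_1].
have [g2 [us2 [x2 []]]] := leaf h2 ts2 A2 ts2n ts2_1 z2 min2 Ah2 A2z A2X A2A1.
set t2 := tperm _ _ => -[g2z LM2] [us2n us2_1] minM2 x2A [x2X w2z g2A t2_1].
(* Both leaves have the same size and both starting points lie in the cycle [X], so a power of [z]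
   carries [t1] to [t2]. *)
have /porbitP[i x2E] : x2 \in porbit z x1 by rewrite -(porbits_mem Xz x1X).
set g := z ^+ i in x2E.
have t12 : t1 ^ g = t2.
  by rewrite tpermJ -x2E; congr tperm; rewrite x2E -!permM -!expgD addnC.
have LM1' : hurwitz (h1 :: ts1) (h1 ^ (g1 * g) :: rcons (conjseq us1 g) t2).
  rewrite -t12 -conjseq_rcons conjgM; apply: hurwitz_trans LM1 _.
  have := hurwitz_twist (h1 ^ g1 :: rcons us1 t1) i.
  by rewrite -rcons_cons mulseq_rcons w1z.
have w1w2 : mulseq (h1 ^ (g1 * g) :: conjseq us1 g) = mulseq (h2 ^ g2 :: us2).
  by apply: (mulIg t2); rewrite w2z -z1 (hurwitz_mulseq LM1') -rcons_cons mulseq_rcons.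
apply: (hurwitz_trans LM1'); apply: hurwitz_sym; apply: (hurwitz_trans LM2).
rewrite -!rcons_cons; apply: hurwitz_rcons; apply: hurwitz_sym.
set w := mulseq (h2 ^ g2 :: us2) in w1w2 w2z g2A minM2 *.
(* The end of [t2] outside the leaf: the cycle of [w] through it is what remains of [X]. *)
pose y2 := (z ^+ #|A1|) x2.
apply: (IHn _ _ _ _ w (porbit w y2)) => //.
- by rewrite size_map.
- by rewrite all_map; apply: sub_all us1_1 => s /=; rewrite defectJ.
- have minL1 : defect_sum (h1 :: ts1) <= defect (mulseq (h1 :: ts1)) by rewrite z1.
  have [] := minimal_rcons (L := _ :: _) (minimal_hurwitz LM1' minL1).
  by rewrite w1w2.
- exact: mem_porbits.
- have g1A' : g @: (g1 @: A1) \in porbits w.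
    have -> : w = mulseq (h1 ^ g1 :: us1) ^ g by rewrite -w1w2 -mulseq_conj /= conjgM.
    exact: imset_porbits.
  have x2gA : x2 \in g @: (g1 @: A1) by rewrite x2E imset_f.
  (* A cycle of [w] through [x2] is the common leaf; one that misses both ends of [t2] is a cycle of
     [z] other than [X]. *)
  move=> Y Yw Yy2; have [x2Y|x2Y] := boolP (x2 \in Y).
    have YE := porbits_mem Yw x2Y.
    rewrite {1}YE -(porbits_mem g1A' x2gA) -imset_permM imset_porbits //=.
    by rewrite YE -(porbits_mem g2A x2A) imset_porbits.
  have y2Y : y2 \notin Y by apply: contra Yy2 => y2Y; apply/eqP/porbits_mem.
  have Yz : Y \in porbits z by rewrite -w2z; apply: porbits_mul_tperm_notin.
  have YX : Y != X by apply: contraNneq x2Y => ->.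
  have g1gz : refines (g1 * g) z by apply: refinesM g1z _; apply/refinesX/refines_refl.
  rewrite -{1}(imset_porbit g1gz Yz) imset_porbits ?zh1 //=.
  by rewrite -(imset_porbit g2z Yz) imset_porbits ?zh2.
- by move=> k; rewrite !cycle_countJ.
Qed.

End Leaves.

(** * Existence of permutations and factorizations *)

Section Existence.

Local Open Scope group_scope.

Variable T : finType.
Implicit Types (s t u w c g h z J : {perm T}) (x y v : T) (L ts : seq {perm T}).
Implicit Types (A B X Y : {set T}).

Lemma porbit_full s x : #|porbits s| = 1%N -> porbit s x = [set: T].
Proof.
move=> /eqP/cards1P[X sX]; apply/setP=> y; rewrite [RHS]inE porbit_sym -eq_porbit_mem.
by have := mem_porbits s x; have := mem_porbits s y;
  rewrite sX !inE => /eqP-> /eqP->; rewrite eqxx.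
Qed.

Lemma full_cycle_conj s t :
  #|porbits s| = 1%N -> #|porbits t| = 1%N -> exists g, t = s ^ g.
Proof.
move=> sF tF; have [x _] : exists x : T, true.
  by have /card_gt0P[_ /imsetP[x _ _]] : 0 < #|porbits s|; [rewrite sF | exists x].
have sT : traject s x #|T| =i T.
  by move=> y; rewrite -cardsT -(porbit_full x sF) -porbit_traject porbit_full ?inE.
have Us : uniq (traject s x #|T|).
  by rewrite -cardsT -(porbit_full x sF) uniq_traject_porbit.
have Ut : uniq (traject t x #|T|).
  by rewrite -cardsT -(porbit_full x tF) uniq_traject_porbit.
have idx y : seq.index y (traject s x #|T|) < #|T|.
  by rewrite -[ltnRHS](size_traject s x) index_mem sT.
pose f y := iter (seq.index y (traject s x #|T|)) t x.
have f_inj : injective f.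
  move=> y y' /eqP; rewrite /f -!(nth_traject t (idx _)) nth_uniq ?size_traject ?idx //.
  by move/eqP/(congr1 (nth x (traject s x #|T|))); rewrite !nth_index ?sT.
have iterT u : #|porbits u| = 1%N -> iter #|T| u x = x.
  by move=> uF; rewrite -cardsT -(porbit_full x uF) iter_porbit.
have fE i : i <= #|T| -> f (iter i s x) = iter i t x.
  have T0 : 0 < #|T| by apply/card_gt0P; exists x.
  have fx : f x = x by rewrite /f -(prednK T0) /= eqxx.
  rewrite leq_eqVlt => /predU1P[->|lt_i]; first by rewrite !iterT.
  by rewrite /f -{1}(nth_traject s lt_i) index_uniq ?size_traject.
exists (perm f_inj); apply/permP=> y; rewrite -[y](permKV (perm f_inj)).
move: ((perm f_inj)^-1 y) => {}y; rewrite permJ !permE.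
have /trajectP[i lt_i ->] : y \in traject s x #|T| by rewrite sT.
by rewrite -iterS !fE ?iterS // ltnW.
Qed.

(** * Factorizations with prescribed defects *)

Lemma not_full_join s : 1 < #|porbits s| -> exists x y, x \notin porbit s y.
Proof.
case/card_gt1P=> _ [_ [/imsetP[x _ ->] /imsetP[y _ ->] xy]].
by exists x, y; rewrite -eq_porbit_mem.
Qed.

Lemma exists_joining n s : #|porbits s| = n.+1 ->
  exists ts, [/\ size ts = n, all (fun t => defect t == 1%N) ts
               & #|porbits (s * mulseq ts)| = 1%N].
Proof.
elim: n s => [|n IHn] s sn; first by exists [::]; rewrite mulseq0 mulg1.
have [x [y xy]] : exists x y, x \notin porbit s y by apply: not_full_join; rewrite sn.
have [|ts [tsn ts1 full]] := IHn (s * tperm x y).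
  have := defect_porbits s; have := defect_porbits (s * tperm x y).
  by rewrite defect_join // sn; lia.
exists (tperm x y :: ts); rewrite /= tsn mulseq_cons mulpA; split=> //.
rewrite defect_tperm //; apply: contraNneq xy => ->; exact: porbit_id.
Qed.

(** A cycle through the marked point [x], or the identity; building all factors through the same
    point makes them touch. *)
Definition centered s x := forall y, s y != y -> y \in porbit s x.

Lemma centered_one_cycle s x : centered s x -> one_cycle s.
Proof. by move=> sx y y' /sx ys /sx ys'; apply: porbit_trans ys' _;
  rewrite porbit_sym. Qed.

Lemma centered_join s x y :
  centered s x -> x \notin porbit s y -> centered (s * tperm x y) x.
Proof.
move=> sx xy v; have st := refines_join xy.
have [sv _|] := boolP (s v != v); first exact: refines_porbit st (sx v sv).
rewrite negbK permM => /eqP->; case: tpermP => [->|->|]; rewrite ?porbit_id ?eqxx //.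
by rewrite porbit_sym join_mem.
Qed.

(** The cycle [c] grows by transpositions joining [x] to points outside its cycle in [w * c]. By
    minimality these points are also outside its cycle in [c], so both defects rise together. *)
Lemma extend_cycle w x e : centered w x -> defect w + e < #|T| ->
  exists c, [/\ defect c = e, centered c x, centered (w * c) x
              & defect (w * c) = defect w + e].
Proof.
elim: e => [|e IHe] wx lt_e.
  exists 1; rewrite defect1 mulg1 addn0; split=> // y.
  by rewrite perm1 eqxx.
have [|c [ce cx wcx wce]] := IHe wx; first by lia.
have [y yx] : exists y, x \notin porbit (w * c) y.
  have [y yx] : exists y, y \notin porbit (w * c) x.
    apply/existsP; apply: contraTT lt_e; rewrite negb_exists => /forallP wcT.
    have := defect_porbits (w * c); rewrite (@card_porbits_full _ _ x) ?wce; first lia.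
    by apply/setP=> y; rewrite [RHS]inE; have := wcT y; rewrite negbK.
  by exists y; rewrite porbit_sym.
have [_ cwc] : refines w (w * c) /\ refines c (w * c) by apply: minimal2;
  rewrite wce ce.
have cxy : x \notin porbit c y by apply: contra yx; apply: refines_porbit.
exists (c * tperm x y); rewrite mulpA !defect_join // ce wce addnS; split=> //.
  exact: centered_join.
exact: centered_join.
Qed.

Lemma exists_cycles x (es : seq nat) : 0 \notin es -> sumn es < #|T| ->
  exists L, [/\ map (@defect T) L = es, forall s, s \in L -> proper_cycle s,
    centered (mulseq L) x & defect (mulseq L) = sumn es].
Proof.
elim/last_ind: es => [|es e IHes] es0 lt_es.
  exists [::]; rewrite mulseq0 defect1; split=> // y.
  by rewrite perm1 eqxx.
move: es0 lt_es; rewrite mem_rcons inE negb_or sumn_rcons => /andP[e0 es0] lt_es.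
have [|L [Les LC Lx dL]] := IHes es0; first by lia.
have [|c [ce cx Lcx dLc]] := @extend_cycle (mulseq L) x e Lx; first by rewrite dL.
exists (rcons L c); rewrite map_rcons Les ce mulseq_rcons dLc dL; split=> // s.
rewrite mem_rconsE => /predU1P[->|/LC//]; split; last exact: centered_one_cycle cx.
by rewrite -defect_gt0 ce lt0n eq_sym.
Qed.

(** * Permutations with prescribed cycle lengths *)

Definition porbit_sizes s := [seq #|A| | A : {set T} in porbits s].

Lemma porbits_join s x y : x \notin porbit s y ->
  porbits (s * tperm x y) =
    (porbit s x :|: porbit s y) |: (porbits s :\ porbit s x :\ porbit s y).
Proof.
move=> xy; have st := refines_join xy; have xyt := join_mem xy.
have xE : porbit (s * tperm x y) x = porbit s x :|: porbit s y.
  apply/setP=> v; rewrite inE; apply/idP/idP; first exact: porbit_mul_tperm_sub.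
  case/orP=> [|vy]; first exact: refines_porbit.
  by apply: porbit_trans (refines_porbit st vy) _; rewrite porbit_sym.
apply/setP=> X; rewrite !inE; apply/idP/predU1P => [Xt|[->|/and3P[XB XA Xs]]].
- have [xX|xX] := boolP (x \in X); first by left; rewrite -xE; apply: porbits_mem.
  have yX : y \notin X.
    apply: contra xX => yX; by rewrite (porbits_mem Xt yX).
  right; apply/and3P; split; last by rewrite -(mulgK_tperm s x y);
    apply: porbits_mul_tperm_notin.
    by apply: contraNneq yX => ->; apply: porbit_id.
  by apply: contraNneq xX => ->; apply: porbit_id.
- by rewrite -xE mem_porbits.
apply: porbits_mul_tperm_notin => //.
  by apply: contra XA => xX; apply/eqP/porbits_mem.
by apply: contra XB => yX; apply/eqP/porbits_mem.
Qed.

Lemma perm_enum_setU1 (U : finType) (a : U) (S : {set U}) :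
  a \notin S -> perm_eq (enum (a |: S)) (a :: enum S).
Proof.
move=> aS; apply: uniq_perm; rewrite /= ?enum_uniq ?mem_enum ?aS // => b.
by rewrite mem_enum !inE mem_enum.
Qed.

Lemma porbit_sizes_join s x y : x \notin porbit s y ->
  perm_eq [:: #|porbit s x|, #|porbit s y| & porbit_sizes (s * tperm x y)]
          (#|porbit s x| + #|porbit s y| :: porbit_sizes s).
Proof.
move=> xy; rewrite /porbit_sizes (porbits_join xy) /image_mem.
set A := porbit s x; set B := porbit s y; set R := _ :\ A :\ B.
have AB : A :&: B = set0.
  apply/setP=> v; rewrite !inE; apply: contraNF xy => /andP[vA vB].
  by apply: porbit_trans vB; rewrite porbit_sym.
have RE : porbits s = A |: (B |: R).
  apply/setP=> X; rewrite !inE; have [->|_] := eqVneq X A; first by rewrite mem_porbits.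
  by have [->|] := eqVneq X B; first by rewrite mem_porbits.
have BR : B \notin R by rewrite !inE eqxx.
have ABR : A \notin B |: R.
  rewrite !inE eqxx /= andbF orbF; apply: contraNneq xy => AB'.
  by rewrite -/B -AB' porbit_id.
have UR : A :|: B \notin R.
  rewrite !inE; apply/negP=> /and3P[_ /eqP UA Us]; apply: UA.
  by apply: porbits_mem Us _; rewrite inE porbit_id.
have card_perm (S S' : seq {set T}) : perm_eq S S' -> perm_eq [seq #|X| | X : {set T}
  <- S] [seq #|X| | X : {set T} <- S'].
  exact: perm_map.
have /card_perm := perm_enum_setU1 UR; rewrite /= cardsU AB cards0 subn0 => pU.
have /card_perm := perm_enum_setU1 ABR; rewrite -RE /= => pA.
have /card_perm := perm_enum_setU1 BR; rewrite /= => pB.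
apply: (@perm_trans _ [:: #|A|, #|B|, #|A| + #|B| & [seq #|X| | X : {set T} <- enum
  R]]).
  by rewrite !perm_cons.
apply: (@perm_trans _ (#|A| + #|B| :: #|A| :: [seq #|X| | X : {set T} <- enum (B |:
  R)])).
  by move/seq.permP: pB => pB; apply/seq.permP=> P /=; rewrite pB /=; lia.
by rewrite perm_cons perm_sym.
Qed.

Lemma size_porbit_sizes s : size (porbit_sizes s) = #|porbits s|.
Proof. by rewrite size_map -cardE. Qed.

(** Induction on the defect: a part [a > 1] is replaced by [a - 1] and 1, and a transposition joins
    the two corresponding cycles. *)
Lemma exists_porbit_sizes (p : seq nat) : 0 \notin p -> sumn p = #|T| ->
  exists s, perm_eq (porbit_sizes s) p.
Proof.
have [m] := ubnP (sumn p - size p); elim: m p => // m IHm p lt_m p0 pT.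
have [/all_pred1P p1|/allPn/=[k kp k1]] := boolP (all (pred1 1%N) p).
  exists 1; have psize : size p = #|T| by rewrite -pT {2}p1 sumn_nseq mul1n.
  have sizes1 : porbit_sizes 1 = nseq #|T| 1%N.
    have := size_porbit_sizes 1; have := defect_porbits (1 : {perm T}).
    rewrite defect1 add0n => -> <-; apply/all_pred1P/allP=> k /mapP[X].
    by rewrite mem_enum => /imsetP[x _ ->] ->; rewrite porbit_fix ?perm1 //= cards1.
  by rewrite sizes1 p1 psize.
have [a [ap a1]] : exists a : nat, a \in p /\ a != 1%N by exists k.
have a0 : 0 < a by rewrite lt0n; apply: contraNneq p0 => <-.
pose q : seq nat := rem a p; have pE : perm_eq p (a :: q) := perm_to_rem ap.
have sump : sumn p = a + sumn q := perm_sumn pE.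
have sizep : size p = (size q).+1 := perm_size pE.
have le_q : size q <= sumn q.
  have : 0 \notin q by apply: contra p0 => /mem_rem.
  elim: (q) => //= b r IHr; rewrite inE negb_or => /andP[b0 /IHr].
  by move: b0; rewrite eq_sym -lt0n; lia.
have a2 : 1 < a by rewrite ltn_neqAle eq_sym a1.
have [|||s sq] := IHm [:: a.-1, 1%N & q].
- move: lt_m; rewrite sump sizep /=; lia.
- rewrite !inE !negb_or; apply/and3P; split=> //; first by lia.
  by apply: contra p0 => /mem_rem.
- by rewrite /= -pT sump; lia.
have /mapP[A] : a.-1 \in porbit_sizes s by rewrite (perm_mem sq) mem_head.
rewrite mem_enum => As Aa.
(* Removing [A] before choosing a fixed point keeps the two cycles distinct when [a = 2]. *)
have AE : perm_eq (enum (porbits s)) (A :: enum (porbits s :\ A)).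
  have := @perm_enum_setU1 _ A (porbits s :\ A); rewrite setD1K //; apply.
  by rewrite !inE eqxx.
have ABs : perm_eq (1%N :: q) [seq #|X| | X : {set T} <- enum (porbits s :\ A)].
  rewrite -(perm_cons a.-1) {2}Aa perm_sym; apply: perm_trans sq.
  by rewrite perm_sym; apply: (perm_map (fun X : {set T} => #|X|) AE).
have /mapP[B] : 1%N \in [seq #|X| | X : {set T} <- enum (porbits s :\ A)].
  by rewrite -(perm_mem ABs) mem_head.
rewrite mem_enum !inE => /andP[BA Bs] B1.
have /imsetP[x _ AE'] := As; have /imsetP[y _ BE] := Bs.
have xy : x \notin porbit s y.
  by rewrite -eq_porbit_mem -AE' -BE eq_sym.
exists (s * tperm x y); have := porbit_sizes_join xy.
rewrite -AE' -BE -Aa -B1 addn1 prednK // => /seq.permP joinE.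
apply/seq.permP=> P; move/seq.permP/(_ P): sq => /= sq;
  move/seq.permP/(_ P): pE => /= pE.
by have := joinE P; rewrite /= sq pE; lia.
Qed.

End Existence.

(** * Cycle types and pure partitions *)

Section CycleTypes.

Local Open Scope group_scope.

Variable d : nat.
Implicit Types (s t c g h z : 'S_d) (L ts R : seq 'S_d) (p q : seq nat).

Lemma perm_cycle_type s : perm_eq (cycle_type s) (porbit_sizes s).
Proof. by rewrite perm_sort. Qed.

Lemma sorted_geq_eq p q :
  sorted geq p -> sorted geq q -> perm_eq p q -> p = q.
Proof.
apply: sorted_eq => [x y z /= yx zy|x y /=]; first exact: leq_trans zy yx.
by rewrite andbC -eqn_leq => /eqP.
Qed.

Lemma cycle_type_sorted s : sorted geq (cycle_type s).
Proof. by apply: sort_sorted => x y; apply: leq_total. Qed.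

Lemma count_cycle_type (P : pred nat) s :
  count P (cycle_type s) = #|[set X in porbits s | P #|X|]|.
Proof.
move/seq.permP: (perm_cycle_type s) => ->.
rewrite count_map -size_filter cardE; apply/perm_size/uniq_perm.
- by rewrite filter_uniq ?enum_uniq.
- exact: enum_uniq.
by move=> X; rewrite mem_filter !mem_enum in_set andbC.
Qed.

Lemma cycle_type_eq s t : cycle_type s = cycle_type t <-> cycle_count s =1
  cycle_count t.
Proof.
split=> [st k|st].
  by rewrite /cycle_count -!(count_cycle_type (pred1 k)) st.
apply: sorted_geq_eq; rewrite ?cycle_type_sorted //.
by apply/allP=> k _ /=; rewrite !count_cycle_type; apply/eqP/st.
Qed.

Lemma cycle_typeJ s g : cycle_type (s ^ g) = cycle_type s.
Proof. by apply/cycle_type_eq => k; rewrite cycle_countJ. Qed.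

Lemma size_cycle_type s : size (cycle_type s) = #|porbits s|.
Proof. by rewrite size_sort size_porbit_sizes. Qed.

Lemma defect_cycle_type s : defect s = d - size (cycle_type s).
Proof. by rewrite /defect card_ord size_cycle_type. Qed.

Lemma partition_cycle_type s : is_partition d (cycle_type s).
Proof.
apply/and3P; split; first exact: cycle_type_sorted.
  rewrite (perm_mem (perm_cycle_type s)); apply/mapP=> -[X].
  by rewrite mem_enum => /imsetP[x _ ->] /esym/eqP;
    rewrite (negPf (card_porbit_neq0 _ _)).
have partS : partition (porbits s) [set: 'I_d].
  apply/and3P; split.
  - rewrite eqEsubset subsetT; apply/subsetP=> x _; apply/bigcupP.
    by exists (porbit s x); rewrite ?mem_porbits ?porbit_id.
  - apply/trivIsetP=> X Y Xs Ys; apply: contraR => /pred0Pn[x /andP[/= xX xY]].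
    by rewrite (porbits_mem Xs xX) (porbits_mem Ys xY).
  - by apply/imsetP=> -[x _ /setP/(_ x)]; rewrite inE porbit_id.
rewrite (perm_sumn (perm_cycle_type s)) sumnE big_map big_enum /=.
by rewrite -(card_partition partS) cardsT card_ord.
Qed.

Lemma proper_cycle_pure s : proper_cycle s <-> pure (cycle_type s).
Proof.
rewrite /pure (count_cycle_type (fun m => m != 1%N)); split=> [[s1 sC]|].
  have [x sx] := perm_neq1P s1; apply/cards1P; exists (porbit s x).
  apply/setP=> X; rewrite !inE; apply/andP/eqP => [[/imsetP[y _ ->] y1]|->].
    apply/porbit_eq/sC => //; apply: contra y1 => /eqP sy.
    by rewrite porbit_fix // cards1.
  by rewrite mem_porbits card_one_cycle // eqSS -lt0n defect_gt0.
case/cards1P=> X /setP sX.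
have {}sX Y : (Y \in porbits s) && (#|Y| != 1%N) = (Y == X).
  by have := sX Y; rewrite in_set in_set1.
have sE x : s x != x -> porbit s x = X.
  move=> sx; apply/eqP; rewrite -sX mem_porbits /=; apply: contra sx => /cards1P[y yE].
  have := porbit_id s x; have := porbitM s x; rewrite yE !inE => /eqP sxy /eqP xy.
  by rewrite sxy -xy eqxx.
split=> [|x y /sE xX /sE yX]; last by rewrite xX -yX porbit_id.
apply/eqP=> s1; have := sX X; rewrite eqxx => /andP[/imsetP[x _ ->]].
by rewrite s1 porbit_fix ?perm1 ?cards1.
Qed.

(** The parts are positive and weakly decreasing, so the one different from 1 comes first, and the
    number of parts fixes its value. *)
Lemma pure_partitionE p : is_partition d p -> pure p ->
  p = (d - size p).+1 :: nseq (size p).-1 1%N.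
Proof.
case/and3P=> p_sorted p0 /eqP pd; rewrite /pure => p1.
case: p p_sorted p0 pd p1 => // a p ap; rewrite inE negb_or => /andP[a0 p0] /= pd.
have p_all1 : all (pred1 1%N) p -> a :: p = (d - (size p).+1).+1 :: nseq (size p) 1%N.
  move=> p1; have pE := all_pred1P _ _ p1; congr (_ :: _) => //.
  have sp : sumn p = size p by rewrite {1}pE sumn_nseq mul1n.
  by move: pd a0; rewrite sp eq_sym -lt0n; lia.
have [a1|a1] := eqVneq a 1%N; last first.
  rewrite add1n eqSS => p1; apply: p_all1; rewrite all_count; apply/eqP.
  by rewrite -(count_predC (pred1 1%N)) (eqP p1 : count (predC (pred1 1%N)) p = 0)
    addn0.
rewrite add0n => p1; exfalso; have : has (fun m => m != 1%N) p by rewrite has_count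
  (eqP p1).
case/hasP=> b bp b1; have /= := ap.
rewrite a1 path_sortedE; last by move=> x y z /= yx zy; apply: leq_trans zy yx.
case/andP=> /allP/(_ b bp) /= b_le1 _; have : b = 0 by lia.
by move=> b0; rewrite b0 in bp; rewrite bp in p0.
Qed.

Lemma eq_pure_partition p q : is_partition d p -> is_partition d q ->
  pure p -> pure q -> size p = size q -> p = q.
Proof. by move=> pP qP pp pq pq_size; rewrite (pure_partitionE pP pp)
  (pure_partitionE qP pq) pq_size. Qed.

End CycleTypes.

(** * Factorizations of genus 0 *)

Section Factorizations.

Local Open Scope group_scope.

Variable d : nat.
Implicit Types (s t c g h z : 'S_d) (L ts R : seq 'S_d) (p : seq nat) (q : seq (seq
  nat)).

Definition codim p := d - size p.

Lemma hurwitz_cycle_type L1 L2 : hurwitz L1 L2 ->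
  perm_eq (map (@cycle_type d) L1) (map (@cycle_type d) L2).
Proof. by apply: hurwitz_perm => s g; apply: cycle_typeJ. Qed.

Lemma map_defect L : map (@defect _) L = map codim (map (@cycle_type d) L).
Proof. by rewrite -map_comp; apply: eq_map => s; apply: defect_cycle_type. Qed.

Lemma perm_rem (U : eqType) (a : U) (l l' : seq U) :
  a \in l -> perm_eq l l' -> perm_eq (rem a l) (rem a l').
Proof.
move=> al ll'; rewrite -(perm_cons a) -(permPr (perm_to_rem _)) -?(perm_mem ll') //.
by rewrite perm_sym -(permPl ll') perm_sym perm_sym perm_to_rem.
Qed.

Lemma defect1_proper_cycle (T : finType) (t : {perm T}) : defect t = 1%N ->
  proper_cycle t.
Proof.
move=> t1; split; first by rewrite -defect_gt0 t1.
have [x [y [nxy ->]]] := defect1P t1.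
have xy : centered (tperm x y) x.
  move=> v; case: tpermP => [->|->|]; rewrite ?porbit_id ?eqxx // => _.
  by have := porbitM (tperm x y) x; rewrite tpermL.
exact: centered_one_cycle xy.
Qed.

Lemma hurwitz_normal_form L p :
    connected L -> mulseq L = 1 -> (defect_sum L + 2 = 2 * d)%N ->
    p \in map (@cycle_type d) L -> all pure (rem p (map (@cycle_type d) L)) ->
    size p <= (count (fun a => codim a == 1%N) (rem p (map (@cycle_type d) L))).+1 ->
  exists h ts R, [/\ hurwitz L ((h :: ts) ++ R), cycle_type h = p,
    size ts = (size p).-1 /\ all (fun s => defect s == 1%N) ts,
    #|porbits (mulseq (h :: ts))| = 1%N
    & (forall s, s \in R -> proper_cycle s) /\
      perm_eq (map (@cycle_type d) (ts ++ R)) (rem p (map (@cycle_type d) L))].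
Proof.
move=> conn prod1 genus0 pL pureL le_p.
have /mapP[h hL hp] := pL; have [M LM] := hurwitz_mem_front hL.
have Mrem : perm_eq (map (@cycle_type d) M) (rem p (map (@cycle_type d) L)).
  rewrite -(perm_cons p) -(permPr (perm_to_rem pL)) perm_sym {1}hp.
  exact: hurwitz_cycle_type LM.
have hn : #|porbits h| = (size p).-1.+1.
  rewrite hp size_cycle_type prednK //; have d0 : 0 < d by lia.
  by apply/card_gt0P; exists (porbit h (Ordinal d0)); apply: mem_porbits.
have [||||ts [R [MR tsn ts1 full]]] := join_cycles hn (R := M).
- by rewrite -(hurwitz_mulseq LM).
- exact: hurwitz_connected LM conn.
- by rewrite -(hurwitz_defect_sum LM) genus0 card_ord.
- move: le_p; rewrite {1}hp size_cycle_type hn ltnS => /leq_trans; apply.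
  by rewrite -(seq.permP Mrem) count_map; apply/eq_leq/eq_count => s /=;
    rewrite defect_cycle_type.
have typeR : perm_eq (map (@cycle_type d) (ts ++ R)) (rem p (map (@cycle_type d) L)).
  by rewrite -(permPr Mrem) perm_sym; apply: hurwitz_cycle_type.
exists h, ts, R; split=> //.
- by apply: hurwitz_trans LM _; apply: (hurwitz_cons h MR).
- by rewrite mulseq_cons.
split=> // s sR; apply/proper_cycle_pure; apply: (allP pureL).
by rewrite -(perm_mem typeR); apply: map_f; rewrite mem_cat sR orbT.
Qed.

Lemma full_porbits z : #|porbits z| = 1%N -> porbits z = [set [set: 'I_d]].
Proof.
move=> zF; have /cards1P[X zX] : #|porbits z| == 1%N by rewrite zF.
have /imsetP[x _ XE] : X \in porbits z by rewrite zX inE.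
by rewrite zX XE porbit_full.
Qed.

Lemma full_one_cycle z : #|porbits z| = 1%N -> one_cycle z.
Proof. by move=> zF x y _ _; rewrite porbit_full ?inE. Qed.

Theorem genus0_hurwitz L1 L2 p :
    connected L1 -> connected L2 -> mulseq L1 = 1 -> mulseq L2 = 1 ->
    (defect_sum L1 + 2 = 2 * d)%N ->
    perm_eq (map (@cycle_type d) L1) (map (@cycle_type d) L2) ->
    p \in map (@cycle_type d) L1 -> all pure (rem p (map (@cycle_type d) L1)) ->
    size p <= (count (fun a => codim a == 1%N) (rem p (map (@cycle_type d) L1))).+1 ->
  exists g, hurwitz L1 (conjseq L2 g).
Proof.
move=> conn1 conn2 z1 z2 genus1 types12 pL1 pure1 le_p.
have rem12 := perm_rem pL1 types12.
have genus2 : (defect_sum L2 + 2 = 2 * d)%N.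
  by rewrite -genus1 /defect_sum !map_defect (perm_sumn (perm_map codim types12)).
have [h1 [ts1 [R1 [LM1 h1p [ts1n ts1_1] F1 [R1C type1]]]]] :=
  hurwitz_normal_form conn1 z1 genus1 pL1 pure1 le_p.
have [|||h2 [ts2 [R2 [LM2 h2p [ts2n ts2_1] F2 [R2C type2]]]]] :=
  @hurwitz_normal_form L2 p conn2 z2 genus2.
- by rewrite -(perm_mem types12).
- by rewrite -(perm_all _ rem12).
- by rewrite -(seq.permP rem12).
(* Conjugation by [g] identifies the two full cycles; the two halves can then be braided
   independently. *)
have [g zg] := full_cycle_conj F2 F1; exists g.
apply: (hurwitz_trans LM1); apply: hurwitz_sym.
apply: (hurwitz_trans (hurwitz_conj g LM2)); apply: hurwitz_sym.
rewrite conjseq_cat; set N2 := conjseq (h2 :: ts2) g; set Q2 := conjseq R2 g.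
have zN2 : mulseq N2 = mulseq (h1 :: ts1) by rewrite mulseq_conj zg.
have dtypes : perm_eq (map (@defect _) (ts1 ++ R1)) (map (@defect _) (ts2 ++ R2)).
  by rewrite !map_defect; apply: perm_map;
    rewrite (permPl type1) perm_sym (permPl type2) perm_sym.
have dts ts : all (fun s => defect s == 1%N) ts -> map (@defect _) ts = nseq (size
  ts) 1%N.
  by elim: ts => //= s ts IH /andP[/eqP-> /IH->].
have dR : perm_eq (map (@defect _) R1) (map (@defect _) R2).
  by move: dtypes; rewrite !map_cat (dts ts1) // (dts ts2) // ts1n ts2n perm_cat2l.
have dz1 : (defect (mulseq (h1 :: ts1))).+1 = d.
  by have := defect_porbits (mulseq (h1 :: ts1)); rewrite F1 card_ord addn1.
have dh : defect h1 + (size p).-1 = (defect (mulseq (h1 :: ts1))).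
  have := defect_porbits h1; have : 0 < #|porbits h1|.
    have d0 : 0 < d by rewrite -dz1.
    by apply/card_gt0P; exists (porbit h1 (Ordinal d0)); apply: mem_porbits.
  by rewrite -size_cycle_type h1p card_ord; lia.
have dsum ts : all (fun s => defect s == 1%N) ts -> defect_sum ts = size ts.
  by move=> ts_1; rewrite /defect_sum dts // sumn_nseq mul1n.
have dh2 : defect h2 = defect h1 by rewrite !defect_cycle_type h1p h2p.
apply: hurwitz_trans (hurwitz_catr R1 _) (hurwitz_catl N2 _).
  apply: (@hurwitz_transpositions _ (size p).-1 _ _ _ _ (mulseq (h1 :: ts1)) [set:
    'I_d]) => //.
  - by rewrite size_map.
  - by rewrite all_map; apply: sub_all ts2_1 => s /=; rewrite defectJ.
  - by rewrite defect_sum_cons dsum // ts1n dh.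
  - rewrite defect_sum_cons dsum ?size_map ?ts2n ?defectJ ?dh2 ?dh //.
    by rewrite all_map; apply: sub_all ts2_1 => s /=; rewrite defectJ.
  - by rewrite full_porbits ?inE.
  - by move=> Y; rewrite full_porbits // !inE => ->.
  by apply/cycle_type_eq; rewrite cycle_typeJ h1p h2p.
have zR1 : mulseq R1 = (mulseq (h1 :: ts1))^-1.
  by apply/eqP; rewrite eq_sym eq_invg_mul -mulseq_cat -(hurwitz_mulseq LM1) z1.
(* The first half uses [d - 1] of the total [2 * d - 2]; the rest equals the defect of the inverse
   full cycle. *)
have dR1 : defect_sum R1 <= defect (mulseq R1).
  have := hurwitz_defect_sum LM1; rewrite defect_sum_cat defect_sum_cons (dsum ts1)
    // ts1n.
  by rewrite zR1 defectV; lia.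
apply: (@hurwitz_cycles _ (size R1)) => //.
- move=> s /mapP[u /R2C[u1 uC] ->]; split; [by rewrite conjg_eq1 | exact: one_cycleJ].
- by rewrite -map_comp (eq_map (g := @defect _)) // => s /=; apply: defectJ.
- rewrite zR1 mulseq_conj zg -conjVg; congr (_ ^ g).
  by apply/eqP; rewrite eq_invg_mul -mulseq_cat -(hurwitz_mulseq LM2) z2.
by rewrite zR1; apply/one_cycleV/full_one_cycle.
Qed.

Lemma size_partition_le p : is_partition d p -> size p <= d.
Proof.
case/and3P=> _ p0 /eqP <-; elim: p p0 => //= a p IHp;
  rewrite inE negb_or => /andP[a0 /IHp].
by move: a0; rewrite eq_sym -lt0n; lia.
Qed.

Lemma map_cycle_type L q :
    (forall s, s \in L -> proper_cycle s) -> all (is_partition d) q -> all pure q ->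
    map (@defect _) L = map codim q ->
  map (@cycle_type d) L = q.
Proof.
elim: L q => [|s L IHL] [|p q] //= LC /andP[dp dq] /andP[pp pq] [ds dL].
congr (_ :: _); last by apply: IHL => // u uL; apply: LC; rewrite inE uL orbT.
apply: (eq_pure_partition (partition_cycle_type s) dp _ pp).
  by apply/proper_cycle_pure/LC; rewrite mem_head.
have := size_partition_le dp; have := size_partition_le (partition_cycle_type s).
by move: ds; rewrite defect_cycle_type /codim; lia.
Qed.

Lemma exists_cycle_type p : is_partition d p -> exists h : 'S_d, cycle_type h = p.
Proof.
case/and3P=> p_sorted p0 /eqP pd.
have [|h hp] := @exists_porbit_sizes 'I_d p p0; first by rewrite card_ord.
exists h; apply: sorted_geq_eq; rewrite ?cycle_type_sorted //.
by rewrite (permPl (perm_cycle_type h)).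
Qed.

(** The tuple is built in normal form: [h] with joining transpositions, then a factorization of a
    full cycle into cycles, conjugated so that its product is the required inverse. Connectedness
    holds because the first half already multiplies to a full cycle. *)
Theorem exists_genus0 p q :
    is_partition d p -> all (is_partition d) q -> all pure q ->
    size p <= (count (fun a => codim a == 1%N) q).+1 ->
    (codim p + sumn (map codim q) + 2 = 2 * d)%N ->
  exists L, [/\ perm_eq (map (@cycle_type d) L) (p :: q), mulseq L = 1 & connected L].
Proof.
move=> dp dq pq le_p genus0.
have [h hp] := exists_cycle_type dp.
have d0 : 0 < d by lia.
pose x0 := Ordinal d0.
have [n hn] : exists n, #|porbits h| = n.+1.
  exists #|porbits h|.-1; rewrite prednK //.
  by apply/card_gt0P; exists (porbit h x0); apply: mem_porbits.
have pn : size p = n.+1 by rewrite -hp size_cycle_type.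
have [ts [tsn ts1 full]] := exists_joining hn.
pose P := fun a => codim a == 1%N.
(* [q1] supplies the [n] joining transpositions; by genus 0 the types left in [q2] have total
   codimension [d - 1], that of a full cycle. *)
pose q1 := take n (filter P q); pose q2 := drop n (filter P q) ++ filter (predC P) q.
have q12 : perm_eq q (q1 ++ q2).
  by rewrite /q1 /q2 catA cat_take_drop perm_sym perm_filterC.
have q1n : size q1 = n.
  by rewrite size_take_min size_filter; apply/minn_idPl; rewrite -ltnS -pn.
have q1P : map codim q1 = nseq n 1%N.
  rewrite -q1n; have : all P q1.
    by apply/allP=> a /mem_take; rewrite mem_filter => /andP[].
  by elim: (q1) => //= a r IH /andP[/eqP-> /IH->].
have q2sum : (sumn (map codim q2) = d.-1)%N.
  have qE : (sumn (map codim q) = n + sumn (map codim q2))%N.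
    by rewrite (perm_sumn (perm_map codim q12)) map_cat sumn_cat q1P sumn_nseq mul1n.
  by move: genus0; rewrite qE {1}/codim pn; have := size_partition_le dp; rewrite pn;
    lia.
have [dq2 pq2] : all (is_partition d) q2 /\ all pure q2.
  by move: dq pq; rewrite !(perm_all _ q12) !all_cat => /andP[_ ->] /andP[_ ->].
have [dq1 pq1] : all (is_partition d) q1 /\ all pure q1.
  by move: dq pq; rewrite !(perm_all _ q12) !all_cat => /andP[-> _] /andP[-> _].
have [||R [dR RC _ zR]] := exists_cycles x0 (es := map codim q2).
- apply/mapP=> -[a aq2]; have ap := allP dq2 a aq2; have pa := allP pq2 a aq2.
  move=> a0; have := pure_partitionE ap pa; have := size_partition_le ap.
  move: a0 pa; rewrite /codim => a0 pa le_a aE.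
  move: pa; rewrite aE -a0 /pure /= add0n; move/eqP => cnt.
  by have := count_nseq (fun m => m != 1%N) (size a).-1 1%N; rewrite cnt /= mul0n.
- by rewrite q2sum card_ord; lia.
have zRF : #|porbits (mulseq R)| = 1%N.
  by have := defect_porbits (mulseq R); rewrite zR q2sum card_ord; lia.
have [g zg] := full_cycle_conj zRF (etrans (congr1 (fun A : {set {set 'I_d}} => #|A|)
  (porbitsV (h * mulseq ts))) full).
exists ((h :: ts) ++ conjseq R g); split.
- rewrite map_cat /= hp; rewrite perm_cons (permPr q12).
  have -> : map (@cycle_type d) ts = q1.
    apply: map_cycle_type => //.
      by move=> s /(allP ts1)/eqP; apply: defect1_proper_cycle.
    rewrite q1P -tsn; elim: (ts) ts1 => //= s ts' IH /andP[/eqP-> /IH->] //.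
  suff -> : map (@cycle_type d) (conjseq R g) = q2 by [].
  rewrite -map_comp (eq_map (g := @cycle_type d)); last by move=> s /=;
    apply: cycle_typeJ.
  exact: map_cycle_type.
- by rewrite mulseq_cat mulseq_conj -zg mulseq_cons mulgV.
move=> B /set0Pn[x xB] LB; apply/setP=> y; rewrite inE.
have zB : preserves B (h * mulseq ts).
  have: forall s, s \in h :: ts -> preserves B s.
    by move=> s sL; apply: LB; rewrite mem_cat sL.
  rewrite -mulseq_cons; elim: (h :: ts) => [|s L IHL] LB' v.
    by rewrite mulseq0 perm1.
  rewrite mulseq_cons permM IHL ?LB' ?mem_head // => u uL.
  by apply: LB'; rewrite inE uL orbT.
by apply: (closed_porbit (s := h * mulseq ts)) xB _ => [v|];
  rewrite ?zB // porbit_full ?inE.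
Qed.

End Factorizations.

(** * The braid group action *)

Section BraidAction.

Local Open Scope group_scope.

Variables n d : nat.
Implicit Types (t u : branch_tuple n d) (L : seq 'S_d) (eta : n.-tuple (seq nat)).

Definition tuple_seq t : seq 'S_d := [seq t i | i : 'I_n].

(** The default 1 is reached only by lists shorter than [n]. *)
Definition seq_tuple L : branch_tuple n d := [ffun i : 'I_n => nth 1 L i].

Lemma size_tuple_seq t : size (tuple_seq t) = n.
Proof. by rewrite size_map size_enum_ord. Qed.

Lemma nth_tuple_seq t (i : 'I_n) : nth 1 (tuple_seq t) i = t i.
Proof. by rewrite (nth_map i) ?size_enum_ord // nth_ord_enum. Qed.

Lemma tuple_seqK t : seq_tuple (tuple_seq t) = t.
Proof. by apply/ffunP=> i; rewrite ffunE nth_tuple_seq. Qed.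

Lemma seq_tupleK L : size L = n -> tuple_seq (seq_tuple L) = L.
Proof.
move=> Ln; apply: (@eq_from_nth _ 1); first by rewrite size_tuple_seq.
rewrite size_tuple_seq => i lt_i.
by rewrite (nth_tuple_seq _ (Ordinal lt_i)) ffunE.
Qed.

Lemma half_twist_step L1 s s' L2 (i j : 'I_n) :
    i = size L1 :> nat -> j = i.+1 :> nat ->
  half_twist d i j (seq_tuple (L1 ++ s :: s' :: L2)) =
  seq_tuple (L1 ++ s' :: s ^ s' :: L2).
Proof.
move=> iL ji; apply/ffunP=> k; rewrite permE !ffunE !nth_cat ji iL ltnNge leqnSn /=.
rewrite subSnn ltnn subnn /= -!val_eqE /= ji iL.
have [->|ki] := eqVneq (k : nat) (size L1); first by rewrite ltnn subnn.
have [->|ki'] := eqVneq (k : nat) (size L1).+1.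
  by rewrite ltnNge leqnSn /= subSnn.
case: ltnP => // le_k.
have lt_k : (size L1).+1 < k by rewrite ltn_neqAle eq_sym ki' ltn_neqAle eq_sym ki.
by rewrite -(subnK lt_k) !addnS -!addSn addnK.
Qed.

Lemma half_twist_hurwitz t (i j : 'I_n) :
  j = i.+1 :> nat -> hurwitz (tuple_seq t) (tuple_seq (half_twist d i j t)).
Proof.
move=> ji; set K := tuple_seq t; have Kn := size_tuple_seq t; rewrite -/K in Kn.
have lt_j : i.+1 < size K by rewrite Kn -ji.
have KE : K = take i K ++ nth 1 K i :: nth 1 K i.+1 :: drop i.+2 K.
  by rewrite -(drop_nth _ lt_j) -(drop_nth _ (ltnW lt_j)) cat_take_drop.
set a := nth 1 K i in KE; set b := nth 1 K i.+1 in KE.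
have -> : half_twist d i j t = seq_tuple (take i K ++ b :: a ^ b :: drop i.+2 K).
  rewrite -(@half_twist_step _ _ _ _ i j) //;
    last by rewrite size_takel // ltnW // ltnW.
  by rewrite -KE tuple_seqK.
rewrite seq_tupleK; first by rewrite {1}KE; apply: hurwitz_step.
by apply: etrans Kn; rewrite [in RHS]KE !size_cat.
Qed.

Lemma hurwitz_braid L1 L2 : hurwitz L1 L2 -> size L1 = n ->
  exists2 b, b \in braid_group n d & b (seq_tuple L1) = seq_tuple L2.
Proof.
elim=> [L|L M LM IH Mn|L M N LM IH1 MN IH2 Ln|M s s' N Mn].
- by exists 1; rewrite ?group1 ?perm1.
- have [|b bB <-] := IH; first by rewrite (hurwitz_size LM).
  by exists b^-1; rewrite ?groupV ?permK.
- have [b bB bE] := IH1 Ln.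
  have [|c cB cE] := IH2; first by rewrite -(hurwitz_size LM).
  by exists (b * c); rewrite ?groupM // permM bE.
have lt_i : size M < n by rewrite -Mn size_cat /=; lia.
have lt_j : (size M).+1 < n by rewrite -Mn size_cat /=; lia.
exists (half_twist d (Ordinal lt_i) (Ordinal lt_j)); last exact: half_twist_step.
apply: mem_gen; apply/imsetP; exists (Ordinal lt_i, Ordinal lt_j) => //.
by rewrite inE.
Qed.

(** For [d = 0] the two sides differ: [connected] holds vacuously, while no action is transitive on
    the empty set. *)
Lemma connected_transitive t : 0 < d ->
  [transitive <<[set t i | i : 'I_n]>>, on [set: 'I_d] | 'P] <-> connected (tuple_seq
    t).
Proof.
move=> d0; set G := <<_>>; split=> [trG B /set0Pn[x xB] LB|conn].
  apply/setP=> y; rewrite inE.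
  have GB : G \subset 'N(B | 'P).
    rewrite gen_subG; apply/subsetP=> _ /imsetP[i _ ->]; apply/astabsP=> z.
    by apply: LB; apply: map_f; rewrite mem_enum.
  have [a aG ->] := atransP2 trG (in_setT x) (in_setT y).
  by rewrite (astabs_act _ (subsetP GB a aG)).
apply/imsetP; exists (Ordinal d0); first by rewrite inE.
apply/esym/conn; first by apply/set0Pn; exists (Ordinal d0); apply: orbit_refl.
move=> _ /mapP[i _ ->] z; apply: (orbit_actr 'P).
by apply: mem_gen; apply: imset_f.
Qed.

Lemma monodromyP eta t : 0 < d -> reflect
    [/\ perm_eq (map (@cycle_type d) (tuple_seq t)) eta,
        mulseq (tuple_seq t) = 1 & connected (tuple_seq t)]
  (t \in monodromy_tuples d eta).
Proof.
move=> d0; rewrite inE.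
have -> : \prod_(i < n) t i = mulseq (tuple_seq t).
  by rewrite /mulseq big_map enumT [index_enum _]unlock.
have -> : [seq cycle_type (t i) | i : 'I_n] = map (@cycle_type d) (tuple_seq t).
  by rewrite -map_comp.
apply: (iffP and3P) => -[types /eqP prod1 conn]; split=> //; try exact/eqP.
  exact/(connected_transitive t d0).
exact/(connected_transitive t d0).
Qed.

Lemma braid_monodromy eta b t : 0 < d ->
  b \in braid_group n d -> (b t \in monodromy_tuples d eta) = (t \in monodromy_tuples
    d eta).
Proof.
move=> d0; suff /subsetP sB : braid_group n d \subset 'N(monodromy_tuples d eta | 'P).
  by move/sB/astabsP; apply.
rewrite gen_subG; apply/subsetP=> s /imsetP[[i j]]; rewrite inE /= => /eqP ji ->.
suff : preserves (monodromy_tuples d eta) (half_twist d i j) by move=> twM;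
  apply/astabsP.
apply: preservesP => u /(monodromyP _ _ d0)[types prod1 conn].
have tw := half_twist_hurwitz u ji; apply/(monodromyP _ _ d0); split.
- by rewrite -(permPl (hurwitz_cycle_type tw)).
- by rewrite -(hurwitz_mulseq tw).
exact: hurwitz_connected tw conn.
Qed.

Lemma conj_tupleM t x y : conj_tuple (conj_tuple t x) y = conj_tuple t (x * y).
Proof. by apply/ffunP=> i; rewrite !ffunE conjgM. Qed.

Lemma conj_class_conj t x : conj_class (conj_tuple t x) = conj_class t.
Proof.
apply/setP=> u; apply/imsetP/imsetP => -[y _ ->].
  by exists (x * y); rewrite ?conj_tupleM.
by exists (x^-1 * y); rewrite ?conj_tupleM ?mulKVg.
Qed.

Lemma conj_tuple_inj x : injective (fun t => conj_tuple t x).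
Proof.
move=> t u /(congr1 (fun v => conj_tuple v x^-1)); rewrite !conj_tupleM mulgV.
by move/ffunP=> E; apply/ffunP=> i; have := E i; rewrite !ffunE !conjg1.
Qed.

(** Simultaneous conjugation is a permutation [c] of the tuples; it suffices that the half twists
    lie in its centralizer. *)
Lemma braid_conj b t x : b \in braid_group n d -> b (conj_tuple t x) = conj_tuple (b
  t) x.
Proof.
pose c := perm (@conj_tuple_inj x); suff sB : braid_group n d \subset 'C[c].
  by move/(subsetP sB)/cent1P/permP/(_ t); rewrite !permM !permE.
rewrite gen_subG; apply/subsetP=> _ /imsetP[[i j] _ ->]; apply/cent1P/permP=> u.
rewrite !permM !permE; apply/ffunP=> k; rewrite !ffunE /=.
by case: eqP => // _; case: eqP => // _; rewrite conjJg.
Qed.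

Lemma braid_conj_class b t : b \in braid_group n d ->
  ('P^* )%act (conj_class t) b = conj_class (b t).
Proof.
move=> bB; apply/setP=> u; apply/imsetP/imsetP => [[_ /imsetP[x _ ->] ->]|[x _ ->]].
  by exists x; rewrite //= apermE braid_conj.
by exists (conj_tuple t x); [apply: imset_f | rewrite /= apermE braid_conj].
Qed.

Lemma hurwitz_irreducibleP eta t : 0 < d -> t \in monodromy_tuples d eta ->
    (forall u, u \in monodromy_tuples d eta ->
      exists g, hurwitz (tuple_seq t) (conjseq (tuple_seq u) g)) ->
  hurwitz_irreducible d eta.
Proof.
move=> d0 tM trM; apply/imsetP; exists (conj_class t); first exact: imset_f.
apply/setP=> S; apply/imsetP/orbitP => [[u uM ->]|[b bB <-]]; last first.
  by exists (b t); rewrite ?braid_monodromy ?braid_conj_class.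
have [g tug] := trM u uM; have [b bB] := hurwitz_braid tug (size_tuple_seq t).
rewrite tuple_seqK => btE; exists b => //; rewrite braid_conj_class // btE.
rewrite -(conj_class_conj u g); congr conj_class; apply/ffunP=> i.
by rewrite !ffunE (nth_map 1) ?size_tuple_seq // nth_tuple_seq.
Qed.

End BraidAction.

(** * Choice of the special partition and conclusion *)

Lemma codim_gt0 d p :
  is_partition d p -> p <> trivial_partition d -> 0 < codim d p.
Proof.
move=> dp p_nontrivial; have [h hp] := exists_cycle_type dp.
rewrite /codim -hp -defect_cycle_type defect_gt0; apply/eqP=> h1; apply: p_nontrivial.
have : cycle_type h = nseq (size (cycle_type h)) 1%N.
  apply/all_pred1P/allP=> k; rewrite (perm_mem (perm_cycle_type h)) => /mapP[X].
  by rewrite mem_enum => /imsetP[x _ ->] ->; rewrite h1 porbit_fix ?perm1 //= cards1.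
have := defect_porbits h; rewrite {1}h1 defect1 add0n card_ord => hd.
by rewrite -hp size_cycle_type hd.
Qed.

Lemma codim1_pure d p : is_partition d p -> codim d p = 1 -> pure p.
Proof.
move=> /exists_cycle_type[h <-]; rewrite /codim -defect_cycle_type => h1.
exact/proper_cycle_pure/defect1_proper_cycle.
Qed.

(* p is the impure part, or else a part that is not a transposition if any. *)
Lemma exists_special_partition d (eta : seq (seq nat)) :
    eta <> [::] -> {in eta, forall p, is_partition d p} ->
    {in eta, forall p, p <> trivial_partition d} ->
    sumn (map (codim d) eta) + 2 = 2 * d ->
    count (fun p => ~~ pure p) eta <= 1 ->
    d <= count (pred1 (transposition_type d)) eta + 3 ->
  exists p, [/\ p \in eta, all pure (rem p eta)
    & size p <= (count (fun a => codim d a == 1) (rem p eta)).+1].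
Proof.
move=> eta0 dp p_nontriv genus0 count_pure count_transp.
have codim0 p : p \in eta -> 0 < codim d p.
  by move=> pe; apply: codim_gt0; [apply: dp | apply: p_nontriv].
have pure_rem p : p \in eta -> (~~ pure p) || all pure eta -> all pure (rem p eta).
  move=> pe; case/orP=> pp; last by apply/allP=> a /mem_rem; apply: (allP pp).
  apply/allP=> a ar; apply: contraLR count_pure => a1.
  rewrite -ltnNge (seq.permP (perm_to_rem pe)) /= pp ltnS -has_count.
  by apply/hasP; exists a.
have [p [pe pp p2]] : exists p, [/\ p \in eta, all pure (rem p eta)
    & 1 < codim d p \/ all (fun a => codim d a == 1) eta].
  have [pure_eta|/allPn[p pe pp]] := boolP (all pure eta); last first.
    exists p; split=> //; first by apply: pure_rem; rewrite ?pp.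
    left; rewrite ltn_neqAle codim0 // andbT eq_sym; apply: contra pp => /eqP.
    exact/codim1_pure/dp.
  have [eta1|/allPn[p pe p1]] := boolP (all (fun a => codim d a == 1) eta).
    case: (eta) eta0 pure_rem eta1 pure_eta => // p q _ pure_rem eta1 pure_eta;
      exists p.
    by split; [apply: mem_head | apply: pure_rem;
      rewrite ?mem_head ?pure_eta ?orbT | right].
  exists p; split=> //; first by apply: pure_rem; rewrite ?pure_eta ?orbT.
  by left; rewrite ltn_neqAle codim0 // andbT eq_sym.
exists p; split=> //; rewrite count_rem pe /=.
have size_p : size p <= d - codim d p.
  by rewrite /codim subKn // size_partition_le // dp.
case: p2 => [p2|eta1].
  (* Such a [p] has at most [d - 2] parts, and removing it from [eta] costs no transposition, so
     [d - 3] transpositions suffice. *)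
  have d2 : 1 < d by move: p2; rewrite /codim; lia.
  have : count (pred1 (transposition_type d)) eta <= count (fun a => codim d a == 1)
    eta.
    by apply: sub_count => a /eqP->; rewrite /codim /= size_nseq; lia.
  rewrite (gtn_eqF p2) subn0 => le_count; rewrite (leq_trans size_p) //.
  have : d - codim d p <= d - 2 by rewrite leq_sub2l.
  lia.
(* Here [eta] has [2 * d - 2] members, all of codimension 1; removing one leaves [2 * d - 3], enough
   for the at most [d - 1] parts of [p]. *)
have eta_n : sumn (map (codim d) eta) = size eta.
  by rewrite (_ : map _ eta = nseq (size eta) 1) ?sumn_nseq ?mul1n //;
    elim: (eta) eta1 => //= a q IH /andP[/eqP-> /IH->].
rewrite (allP eta1 p pe); move: eta1; rewrite all_count => /eqP->.
rewrite (leq_trans size_p) // subn1; have : d - codim d p <= d - 1 by rewrite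
  leq_sub2l ?codim0.
by move: genus0; rewrite eta_n; lia.
Qed.

Theorem theorem1p8 (d n : nat) (eta : n.-tuple (seq nat))
  (eta_partition : forall i : 'I_n, is_partition d (tnth eta i))
  (eta_nontrivial : forall i : 'I_n, tnth eta i <> trivial_partition d)
  (eta_genus0 : has_genus 0 d eta)
  (eta_pure : count (fun p => ~~ pure p) eta <= 1)
  (eta_transpositions : d <= count (pred1 (transposition_type d)) eta + 3) :
  hurwitz_irreducible d eta.
Proof.
have genus0 : sumn (map (codim d) eta) + 2 = 2 * d.
  by rewrite sumnE big_map -eta_genus0.
have d0 : 0 < d by lia.
(* Without branch points there is no special partition to choose; genus 0 then forces [d = 1], and
   the only tuple is empty. *)
have [eta0|/eqP eta0] := eqVneq (tval eta) [::].
  have n0 : n = 0 by rewrite -(size_tuple eta) eta0.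
  have d1 : d = 1 by move: genus0; rewrite eta0 /=; lia.
  have L0 (t : branch_tuple n d) : tuple_seq t = [::].
    by apply: size0nil; rewrite size_tuple_seq.
  pose t0 := @seq_tuple n d [::].
  have tM : t0 \in monodromy_tuples d eta.
    apply/monodromyP; rewrite // L0 eta0; split=> //; first exact: mulseq0.
    move=> B /set0Pn[x xB] _; apply/setP=> y; rewrite inE.
    suff -> : y = x by [].
    have ord_eq0 (z : 'I_d) : z = 0 :> nat by have := ltn_ord z; lia.
    by apply: val_inj; rewrite /= !ord_eq0.
  apply: (hurwitz_irreducibleP d0 tM) => u _; exists 1%g.
  by rewrite !L0; apply: hurwitz_refl.
have dp : {in eta, forall p, is_partition d p} by move=> p /tnthP[i ->].
have [|p [pe pp le_p]] := exists_special_partition eta0 dp _ genus0 eta_pure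
  eta_transpositions.
  by move=> p /tnthP[i ->].
have [|||||L [Ltypes Lprod Lconn]] := @exists_genus0 d p (rem p eta).
- exact: dp.
- by apply/allP=> a /mem_rem; apply: dp.
- by [].
- by [].
- by rewrite -genus0 (perm_sumn (perm_map (codim d) (perm_to_rem pe))).
have Leta : perm_eq (map (@cycle_type d) L) eta.
  by rewrite (permPl Ltypes) perm_sym perm_to_rem.
have Ln : size L = n.
  by have := perm_size Leta; rewrite size_map size_tuple.
have tM : @seq_tuple n d L \in monodromy_tuples d eta.
  by apply/monodromyP; rewrite // seq_tupleK.
apply: (hurwitz_irreducibleP d0 tM) => u /(monodromyP _ _ d0)[utypes uprod uconn].
rewrite seq_tupleK //; have Lrem : perm_eq (rem p (map (@cycle_type d) L)) (rem p eta).
  by apply: (perm_rem _ Leta); rewrite (perm_mem Leta).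
apply: (@genus0_hurwitz d _ _ p) => //.
- by rewrite /defect_sum map_defect (perm_sumn (perm_map (codim d) Leta)).
- by rewrite (permPl Leta) perm_sym.
- by rewrite (perm_mem Leta).
- by rewrite (perm_all _ Lrem).
by rewrite (seq.permP Lrem).
Qed.
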